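(* Let $m\geq 1$, let $C_m$ be the cyclic group of order $m$, let $V$ be a rational FPF representation of $C_m$ of dimension $n=\dim_{\mathbb{Q}}V$, let $L\subset V$ be a $C_m$-invariant full-rank lattice, and consider the induced $C_m$-action on $V_{\mathbb{C}}/L$. Then the orbifold Euler characteristic of the quotient $V_{\mathbb{C}}/(C_m\ltimes L)=(V_{\mathbb{C}}/L)/C_m$ is \[\chi_{\mathrm{orb}}(V_{\mathbb{C}}/(C_m\ltimes L))=\frac{m-1}{m}+\frac{1}{m}\sum_{p^k\mid m} \varphi(p^k)\Bigl(p^{\frac{n}{\varphi(p^k)}}-1\Bigr),\] where the sum ranges over all prime power divisors $p^k$ of $m$ ($p$ prime, $k\ge 1$).
   Context: A rational FPF (fixed-point-free) representation of a finite group $G$ is a nonzero finite-dimensional $\mathbb{Q}$-vector space $V$ with a linear $G$-action such that $\det(g-\mathrm{id}\mid V)\neq 0$ for every non-identity $g\in G$. A $G$-invariant full-rank lattice $L\subset V$ is a $G$-stable free $\mathbb{Z}$-submodule spanned by a $\mathbb{Q}$-basis of $V$. Put $V_{\mathbb{C}}=V\otimes_{\mathbb{Q}}\mathbb{C}$; the action of $G$ extends $\mathbb{C}$-linearly to $V_{\mathbb{C}}$ and induces an action on the torus $V_{\mathbb{C}}/L\cong(\mathbb{C}/\mathbb{Z})^n$ by $g\cdot[x]=[gx]$. For a finite group $G$ acting on a space $X$, the orbifold Euler characteristic is $\chi_{\mathrm{orb}}(X/G):=\frac{1}{|G|}\sum_{g\in G}\chi(\operatorname{Fix}(g))$, where $\operatorname{Fix}(g)=\{x\in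 X: gx=x\}$ and $\chi$ is the ordinary Euler characteristic. $\varphi$ is Euler's totient function. *)

(* Defs.v *)
From HB Require Import structures.
From mathcomp Require Import all_boot all_order all_algebra all_fingroup.
From mathcomp Require Import mxrepresentation complex freeg.
From mathcomp Require Import all_classical all_reals all_analysis.

Set Implicit Arguments.
Unset Strict Implicit.
Unset Printing Implicit Defensive.

Import Order.TTheory GRing.Theory Num.Theory.
Import numFieldNormedType.Exports.

Local Open Scope classical_set_scope.
Local Open Scope ring_scope.
Local Open Scope quotient_scope.

(* The complex numbers, packed as a numeric field so that the topology of     *)
(* the complex modulus is inferred on them and on matrices over them.         *)
Definition Cplx (R : realType) : numClosedFieldType := R[i].

Definition std_simplex (R : realType) (k : nat) : set 'rV[R]_k.+1 :=
  [set x | (forall i, 0 <= x 0 i) /\ \sum_i x 0 i = 1].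
Arguments std_simplex R k : clear implicits.

Section Coface.
Variables (R : realType) (k : nat) (i : 'I_k.+2).

(* Inserts a zero coordinate at position i. *)
Definition coface_row (x : 'rV[R]_k.+1) : 'rV[R]_k.+2 :=
  \row_j oapp (x 0) 0 (unlift i j).

Lemma coface_row_simplex (x : std_simplex R k) :
  std_simplex R k.+1 (coface_row (set_val x)).
Proof.
have [x_ge0 x_sum] := set_mem (valP x); split=> [j|].
  by rewrite mxE; case: unlift => [l|] //=.
rewrite (bigD1_ord i) //= mxE unlift_none add0r -[RHS]x_sum.
by apply: eq_bigr => j _; rewrite mxE liftK.
Qed.

Definition coface (x : std_simplex R k) : std_simplex R k.+1 :=
  SigSub (mem_set (coface_row_simplex x)).

Lemma continuous_coface : continuous coface.
Proof.
apply: continuous_comp_initial => x.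
have h j : (fun y : std_simplex R k => coface_row (set_val y) 0 j)
     @ x --> coface_row (set_val x) 0 j.
  have -> : (fun y : std_simplex R k => coface_row (set_val y) 0 j) =
      (fun y => oapp ((set_val y : 'rV[R]_k.+1) 0) 0 (unlift i j)).
    by apply/funext => y; rewrite mxE.
  rewrite mxE; case: unlift => [l|] /=; last first.
    exact: (@cst_continuous _ _ (0 : R) x).
  apply: (@continuous_comp _ _ _ set_val (fun y : 'rV[R]_k.+1 => y 0 l)).
    exact: initial_continuous.
  exact: coord_continuous.
move=> U [P nP PU].
have near_P a b : nbhs x [set y | P a b (coface_row (set_val y) a b)].
  by rewrite (ord1 a); exact: (h b _ (nP 0 b)).
have : nbhs x [set y | forall a b, P a b (coface_row (set_val y) a b)].
  have FF := @nbhs_filter _ x.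
  apply: (@filter_forall _ _ (fun a => _) _ FF) => a.
  by apply: (@filter_forall _ _ (fun b y => _) _ FF) => b; exact: near_P.
by apply: (@filterS _ _ (@nbhs_filter _ x)) => y Py; exact: PU.
Qed.

HB.instance Definition _ := @isContinuous.Build _ _ coface continuous_coface.
End Coface.

Section SingularHomology.
Variables (R : realType) (X : topologicalType).

Definition singular_simplex (k : nat) : choiceType :=
  continuousType (std_simplex R k) X.

Definition face (k : nat) (i : 'I_k.+2) (s : singular_simplex k.+1) :
  singular_simplex k := s \o coface i.

Definition chain (k : nat) : lmodType rat := {freeg (singular_simplex k) / rat}.

Definition boundary (k : nat) : chain k.+1 -> chain k :=
  fglift (fun s => \sum_(i < k.+2) << (-1) ^+ i *g face i s >>).

Definition cycle (k : nat) : chain k -> Prop :=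
  if k is k'.+1 then fun c => boundary c = 0 else fun=> True.

Lemma boundary_is_additive (k : nat) : zmod_morphism (@boundary k).
Proof. exact: lift_is_additive. Qed.

HB.instance Definition _ (k : nat) :=
  GRing.isZmodMorphism.Build (chain k.+1) (chain k) (@boundary k)
    (@boundary_is_additive k).

Lemma boundary_is_scalable (k : nat) : scalable (@boundary k).
Proof.
move=> a c; rewrite -[in LHS](freeg_sumE c) scaler_sumr raddf_sum /=.
rewrite -[in RHS](freeg_sumE c) raddf_sum scaler_sumr; apply: eq_bigr => s _.
have -> : a *: << coeff s c *g s >> = << a * coeff s c *g s >> :> chain k.+1.
  by apply/eqP/freeg_eqP => t; rewrite coeffZ !coeffU mulrA.
by rewrite /boundary liftU -scalerA; congr (_ *: _); rewrite [RHS]liftU.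
Qed.

HB.instance Definition _ (k : nat) :=
  GRing.isScalable.Build rat (chain k.+1) (chain k) *:%R (@boundary k)
    (@boundary_is_scalable k).

(* b = dim H_k(X; Q): some b cycles represent a basis of the homology space,  *)
(* i.e. every cycle is, modulo boundaries, a unique combination of them.      *)
Definition is_betti (k b : nat) : Prop :=
  exists z : 'I_b -> chain k, (forall i, cycle (z i)) /\
    forall c, cycle c ->
      exists! a : 'rV[rat]_b,
        exists d : chain k.+1, c - \sum_i a 0 i *: z i = boundary d.

(* The total rational homology of X is required to be finite-dimensional.     *)
Definition is_euler_char (chi : int) : Prop :=
  exists (b : nat -> nat) (N : nat),
    [/\ forall k, is_betti k (b k),
        forall k, (N <= k)%N -> b k = 0%N
      & chi = \sum_(k < N) (-1) ^+ k * (b k)%:Z].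

Lemma is_betti_le (k b b' : nat) : is_betti k b -> is_betti k b' -> (b <= b')%N.
Proof.
move=> [z [cz genz]] [w [cw genw]].
have [A hA] : exists A : 'M[rat]_(b, b'), forall i,
    exists d : chain k.+1, z i - \sum_j A i j *: w j = boundary d.
  have /choice[a ha] i : exists a : 'rV[rat]_b', exists d : chain k.+1,
      z i - \sum_j a 0 j *: w j = boundary d.
    by have [a [? _]] := genw _ (cz i); exists a.
  exists (\matrix_(i, j) a i 0 j) => i; have [d e] := ha i; exists d.
  by rewrite -e; under eq_bigr do rewrite mxE.
have [B hB] : exists B : 'M[rat]_(b', b), forall i,
    exists d : chain k.+1, w i - \sum_j B i j *: z j = boundary d.
  have /choice[a ha] i : exists a : 'rV[rat]_b, exists d : chain k.+1,
      w i - \sum_j a 0 j *: z j = boundary d.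
    by have [a [? _]] := genz _ (cw i); exists a.
  exists (\matrix_(i, j) a i 0 j) => i; have [d e] := ha i; exists d.
  by rewrite -e; under eq_bigr do rewrite mxE.
apply: (@mulmx1_min _ _ _ A B); apply/row_matrixP => i.
have [a [_ a_uniq]] := genz _ (cz i).
transitivity a; last first.
  apply: a_uniq; exists 0; rewrite linear0.
  rewrite (bigD1 i) //= !mxE eqxx scale1r big1 ?addr0 ?subrr // => j ji.
  by rewrite !mxE eq_sym (negPf ji) scale0r.
apply/esym/a_uniq.
have [d hd] := hA i; have /choice[e he] := hB.
exists (d + \sum_j A i j *: e j).
have -> : boundary (d + \sum_j A i j *: e j)
    = boundary d + \sum_j A i j *: (w j - \sum_l B j l *: z l).
  rewrite linearD; congr (_ + _).
  by rewrite linear_sum; apply: eq_bigr => j _; rewrite linearZ /= he.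
rewrite -hd; under [X in _ = _ + X]eq_bigr do rewrite scalerBr.
rewrite sumrB addrA subrK; congr (_ - _).
under [RHS]eq_bigr do rewrite scaler_sumr.
rewrite exchange_big /=; apply: eq_bigr => l _.
by rewrite !mxE scaler_suml; apply: eq_bigr => j _; rewrite scalerA.
Qed.

Lemma is_betti_uniq (k b b' : nat) : is_betti k b -> is_betti k b' -> b = b'.
Proof. by move=> hb hb'; apply/eqP; rewrite eqn_leq !(@is_betti_le k). Qed.

Lemma is_euler_char_uniq (chi chi' : int) :
  is_euler_char chi -> is_euler_char chi' -> chi = chi'.
Proof.
move=> [b [N [hb b0 ->]]] [b' [N' [hb' b0' ->]]].
have eb k : b' k = b k by exact: is_betti_uniq (hb' k) (hb k).
have ext M M' : (forall k, (M <= k)%N -> b k = 0%N) -> (M <= M')%N ->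
    \sum_(k < M') (-1) ^+ k * (b k)%:Z = \sum_(k < M) (-1) ^+ k * (b k)%:Z.
  move=> bM /subnKC <-.
  rewrite big_split_ord /= [X in _ + X]big1 ?addr0 // => k _.
  by rewrite bM ?leq_addr // mulr0.
rewrite -(ext _ (maxn N N') b0 (leq_maxl _ _)) (ext N') ?leq_maxr //;
  last by move=> k /b0' <-.
by apply: eq_bigr => k _; rewrite eb.
Qed.

End SingularHomology.

Definition Fix (X : Type) (f : X -> X) : set X := [set x | f x = x].

(* chi_orb(X/G) = e, for the finite group G acting on X by act.               *)
Definition is_orb_euler_char (R : realType) (gT : finGroupType)
    (G : {group gT}) (X : topologicalType) (act : gT -> X -> X) (e : rat) :=
  exists chi : gT -> int,
    (forall g, g \in G -> is_euler_char R (Fix (act g)) (chi g)) /\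
    e = #|G|%:R^-1 * \sum_(g in G) (chi g)%:~R.

Lemma is_orb_euler_char_uniq (R : realType) (gT : finGroupType)
    (G : {group gT}) (X : topologicalType) (act : gT -> X -> X) (e e' : rat) :
  is_orb_euler_char R G act e -> is_orb_euler_char R G act e' -> e = e'.
Proof.
move=> [chi [hchi ->]] [chi' [hchi' ->]]; congr (_ * _).
apply: eq_bigr => g gG.
by rewrite (is_euler_char_uniq (hchi g gG) (hchi' g gG)).
Qed.

(* A representation rG of G on V = Q^n acts on column vectors by              *)
(* g . v = rG g *m v.                                                         *)
Definition is_FPF (gT : finGroupType) (G : {group gT}) (n : nat)
    (rG : mx_representation rat G n) : Prop :=
  (0 < n)%N /\ forall g, g \in G -> g != 1%g -> \det (rG g - 1%:M) != 0.

(* A free Z-submodule of Q^n spanned by a Q-basis, the columns of B.          *)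
Record lattice (n : nat) := Lattice {
  lattice_set : set 'cV[rat]_n;
  lattice_basis : exists2 B : 'M[rat]_n, B \in unitmx &
    lattice_set = [set B *m map_mx intr z | z in [set: 'cV[int]_n]] }.

Definition lattice_invariant (gT : finGroupType) (G : {group gT}) (n : nat)
    (rG : mx_representation rat G n) (L : lattice n) : Prop :=
  forall g v, g \in G -> lattice_set L v -> lattice_set L (rG g *m v).

Section Torus.
Variables (R : realType) (n : nat) (L : lattice n).

Definition lattice_equiv : rel 'cV[Cplx R]_n :=
  fun x y => `[< exists2 l, lattice_set L l & x - y = map_mx ratr l >].

Lemma lattice0 : lattice_set L 0.
Proof.
have [B _ ->] := lattice_basis L; exists 0 => //=.
by rewrite map_mx0 mulmx0.
Qed.

Lemma latticeB u v :
  lattice_set L u -> lattice_set L v -> lattice_set L (u - v).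
Proof.
have [B _ ->] := lattice_basis L => -[x _ <-] [y _ <-]; exists (x - y) => //=.
by rewrite map_mxB mulmxBr.
Qed.

Lemma lattice_equiv_refl : reflexive lattice_equiv.
Proof.
by move=> x; apply/asboolP; exists 0; [exact: lattice0 | rewrite subrr map_mx0].
Qed.

Lemma lattice_equiv_sym : symmetric lattice_equiv.
Proof.
suff h x y : lattice_equiv x y -> lattice_equiv y x.
  by move=> x y; apply/idP/idP; exact: h.
move=> /asboolP[l Ll xyl]; apply/asboolP; exists (- l).
  by rewrite -(sub0r l); apply: latticeB => //; exact: lattice0.
by rewrite map_mxN -xyl opprB.
Qed.

Lemma lattice_equiv_trans : transitive lattice_equiv.
Proof.
move=> y x z /asboolP[l Ll xyl] /asboolP[l' Ll' yzl]; apply/asboolP.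
exists (l - (0 - l')); first by do 2!apply: latticeB => //; exact: lattice0.
by rewrite sub0r opprK map_mxD -xyl -yzl addrA subrK.
Qed.

Canonical lattice_equiv_equivRel :=
  EquivRel lattice_equiv lattice_equiv_refl lattice_equiv_sym
    lattice_equiv_trans.

(* V_C / L for V = Q^n, with the quotient topology.                           *)
Definition torus : topologicalType :=
  quotient_topology {eq_quot lattice_equiv}.

Definition torus_pi (x : 'cV[Cplx R]_n) : torus :=
  \pi_{eq_quot lattice_equiv} x.

Section Action.
Variables (gT : finGroupType) (G : {group gT}) (rG : mx_representation rat G n).

Definition complex_act (g : gT) (x : 'cV[Cplx R]_n) : 'cV[Cplx R]_n :=
  map_mx ratr (rG g) *m x.

(* Well defined on classes when L is G-invariant: see torus_actE.             *)
Definition torus_act (g : gT) (x : torus) : torus :=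
  torus_pi (complex_act g (generic_quotient.repr (x : {eq_quot lattice_equiv}))).

Lemma torus_actE (g : gT) (x : 'cV[Cplx R]_n) :
  lattice_invariant rG L -> g \in G ->
  torus_act g (torus_pi x) = torus_pi (complex_act g x).
Proof.
move=> invL gG; apply/eqmodP/asboolP.
have /eqmodP/asboolP[l Ll xl] :=
  generic_quotient.reprK (torus_pi x : {eq_quot lattice_equiv}).
exists (rG g *m l); first exact: invL.
by rewrite map_mxM -xl mulmxBr.
Qed.

End Action.
End Torus.

Arguments torus R {n} L.
Arguments torus_act R {n} L {gT G} rG g x.

(* Main.v *)
From HB Require Import structures.
Require Import Defs.
From mathcomp Require Import all_boot all_order all_algebra all_fingroup.
From mathcomp Require Import all_solvable all_field mxrepresentation.
From mathcomp Require Import complex freeg.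
From mathcomp Require Import all_classical all_reals all_analysis.
From mathcomp Require Import zify lra ring.

(**
  The Euler characteristic of the fixed locus of every [g] is computed with
  singular chains, and the answers are then summed.

  For [g = 1] the fixed locus is the whole torus [E / Z^n], with [E = C^n].  A
  simplex of the torus lifts to [E], uniquely up to translation, so the singular
  chains of the torus are the coinvariants of those of [E] under [Z^n].  Dividing
  by one generator [t] at a time gives a short exact sequence
  [0 -> C --(t - 1)--> C -> C_t -> 0] of complexes.  Hence, if [C] has finite
  homology, so has [C_t], and its Euler characteristic is [chi(C) - chi(C) = 0].
  The induction starts with [E], which is contracted by coning.

  For [g <> 1] the lift [s] of a simplex in the fixed locus satisfies
  [(g - 1) s(x) \in L], so [s] is constant: the fixed locus behaves like a
  discrete space, with [#(L / (g - 1) L) = |det (g - 1)|] points.  All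
  eigenvalues of an element [g] of order [d] are primitive [d]-th roots of unity,
  since [det (g ^ e - 1) <> 0] for [0 < e < d]; hence the characteristic
  polynomial of [g] is ['Phi_d ^+ (n / phi(d))], and [|det (g - 1)|] is the same
  power of ['Phi_d(1)], which is [p] if [d] is a power of a prime [p] and [1]
  otherwise.
*)

Set Implicit Arguments.
Unset Strict Implicit.
Unset Printing Implicit Defensive.
Import Order.TTheory GRing.Theory Num.Theory.
Import numFieldNormedType.Exports.
Local Open Scope classical_set_scope.
Local Open Scope ring_scope.

(** * Homology of complexes and short exact sequences *)

(** Betti numbers are defined by explicit bases of cycles, so homology spaces are never formed: each
    subquotient is described by a coordinate map on cycles. The rank of [t - 1] on homology is never
    computed either: its corank in degree [k] enters the Betti numbers of the quotient in degrees
    [k] and [k + 1], hence cancels in the Euler characteristic. Generators are divided out one at a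
    time because an infinite cyclic group is resolved by the single map [t - 1]. The intermediate
    quotients are not presented as spaces, so the algebra is done for semi-simplicial sets. In place
    of covering theory, angles are lifted: the real lattice coordinates of a simplex are lifted from
    circles, while the imaginary ones are already functions on the torus. In the final sum each
    [g <> 1] contributes [1], which gives the summand [(m - 1) / m], plus an excess that vanishes
    unless the order of [g] is a prime power; there are [phi(d)] elements of order [d]. *)

(* [phi] identifies [Z / B] with [Q ^ b]; its values outside [Z] are junk. *)
Definition quotient_coords (V : lmodType rat) (Z B : V -> Prop) (b : nat)
    (phi : V -> 'rV[rat]_b) : Prop :=
  [/\ forall a x y, Z x -> Z y -> phi (a *: x + y) = a *: phi x + phi y,
      forall x, Z x -> phi x = 0 <-> B x
    & forall u, exists2 x, Z x & phi x = u].

Definition subspace (V : lmodType rat) (Z : V -> Prop) : Prop :=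
  Z 0 /\ forall a x y, Z x -> Z y -> Z (a *: x + y).

Section QuotientCoords.
Variables (V : lmodType rat).
Implicit Types (Z B : V -> Prop).

Lemma subspace_sum Z I (r : seq I) (a : I -> rat) (z : I -> V) :
  subspace Z -> (forall i, Z (z i)) -> Z (\sum_(i <- r) a i *: z i).
Proof.
move=> [Z0 ZD] Zz; elim: r => [|i r IH]; first by rewrite big_nil.
by rewrite big_cons; apply: ZD.
Qed.

Lemma subspaceB Z x y : subspace Z -> Z x -> Z y -> Z (x - y).
Proof. by move=> [Z0 ZD] Zx Zy; rewrite addrC -scaleN1r; exact: ZD. Qed.

Section Coords.
Variables (Z B : V -> Prop) (b : nat) (phi : V -> 'rV[rat]_b).
Hypotheses (sZ : subspace Z) (phiP : quotient_coords Z B phi).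

Lemma coords0 : phi 0 = 0.
Proof.
have [lin _ _] := phiP; have [Z0 _] := sZ.
by have := lin (-1) 0 0 Z0 Z0; rewrite scaler0 addr0 scaleN1r addNr.
Qed.

Lemma coordsB x y : Z x -> Z y -> phi (x - y) = phi x - phi y.
Proof.
by have [lin _ _] := phiP => Zx Zy; rewrite addrC -scaleN1r lin // scaleN1r addrC.
Qed.

Lemma coords_sum I (r : seq I) (a : I -> rat) (z : I -> V) :
  (forall i, Z (z i)) ->
  phi (\sum_(i <- r) a i *: z i) = \sum_(i <- r) a i *: phi (z i).
Proof.
have [lin _ _] := phiP => Zz; elim: r => [|i r IH].
  by rewrite !big_nil coords0.
by rewrite !big_cons lin ?IH //; exact: subspace_sum.
Qed.

Lemma coords_basis :
  exists2 z : 'I_b -> V, forall i, Z (z i)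
    & forall v : 'rV[rat]_b, phi (\sum_i v 0 i *: z i) = v.
Proof.
have [_ _ sur] := phiP.
have /choice[z zP] i : exists x, Z x /\ phi x = delta_mx 0 i.
  by have [x Zx e] := sur (delta_mx 0 i); exists x.
exists z => [i|v]; first by have [] := zP i.
rewrite coords_sum => [|i]; last by have [] := zP i.
by rewrite [RHS]row_sum_delta; apply: eq_bigr => i _; have [_ ->] := zP i.
Qed.

Lemma coords_eqP x y : Z x -> Z y -> phi x = phi y <-> B (x - y).
Proof.
have [_ ker _] := phiP => Zx Zy.
rewrite -ker; last exact: subspaceB.
by rewrite coordsB //; split => [->|/eqP]; rewrite ?subrr // subr_eq0 => /eqP.
Qed.

End Coords.

(* The class of [x] is often only determined by auxiliary choices, such as a
   preimage of [x]; a linear relation then replaces the function [phi]. *)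
Lemma coords_of_relation Z B b (rho : V -> 'rV[rat]_b -> Prop) :
    subspace Z -> B 0 ->
    (forall a x u y v, rho x u -> rho y v -> rho (a *: x + y) (a *: u + v)) ->
    (forall x, Z x -> exists u, rho x u) ->
    (forall x u, Z x -> rho x u -> u = 0 <-> B x) ->
    (forall u, exists2 x, Z x & rho x u) ->
  exists phi : V -> 'rV[rat]_b, quotient_coords Z B phi.
Proof.
move=> [Z0 ZD] B0 lin tot ker sur.
have uniq x u v : Z x -> rho x u -> rho x v -> u = v.
  move=> Zx xu xv; have := lin (-1) x u x v xu xv.
  rewrite !scaleN1r addNr => /(ker _ _ Z0)[_ /(_ B0)].
  by rewrite addrC => /eqP; rewrite subr_eq0 => /eqP.
have /choice[phi phiP] x : exists u, Z x -> rho x u.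
  have [Zx|nZx] := pselect (Z x); last by exists 0.
  by have [u] := tot x Zx; exists u.
exists phi; split => [a x y Zx Zy|x Zx|u].
- by apply: (uniq (a *: x + y)); [exact: ZD|exact/phiP/ZD|apply: lin; exact: phiP].
- exact: ker (phiP x Zx).
- by have [x Zx xu] := sur u; exists x => //; exact: (uniq x _ _ Zx (phiP x Zx) xu).
Qed.

(** Here [phi] maps onto the kernel of [M] only, and a row basis of that kernel supplies the
    coordinates. This serves the connecting map, whose image is the kernel of the map induced by
    [f]. *)
Lemma coords_kermx Z B b q (M : 'M[rat]_(b, q)) (phi : V -> 'rV[rat]_b) :
    (forall a x y, Z x -> Z y -> phi (a *: x + y) = a *: phi x + phi y) ->
    (forall x, Z x -> phi x = 0 <-> B x) ->
    (forall u, (exists2 x, Z x & phi x = u) <-> u *m M = 0) ->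
  exists psi : V -> 'rV[rat]_(b - \rank M), quotient_coords Z B psi.
Proof.
move=> lin ker im; rewrite -mxrank_ker; set K := row_base (kermx M).
have phiK x : Z x -> (phi x <= K)%MS.
  by move=> Zx; rewrite eq_row_base; apply/sub_kermxP/im; exists x.
exists (fun x => phi x *m pinvmx K); split => [a x y Zx Zy|x Zx|u].
- by rewrite lin // mulmxDl scalemxAl.
- rewrite -ker //; split => [e|->]; last by rewrite mul0mx.
  by rewrite -[LHS](mulmxKpV (phiK x Zx)) e mul0mx.
- have /im[x Zx e] : u *m K *m M = 0.
    by apply/sub_kermxP; rewrite -(eq_row_base (kermx M)) submxMl.
  exists x => //; apply: (row_free_inj (row_base_free (kermx M))).
  by rewrite -/K e mulmxKpV // submxMl.
Qed.

(** Dimensions add along [B <= Z' <= Z]. Subtracting from [x] the chosen lift of [delta x] lands in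
    [Z'], where [psi] gives the remaining coordinates. *)
Lemma coords_extension Z Z' B r s (delta : V -> 'rV[rat]_r)
    (psi : V -> 'rV[rat]_s) :
    subspace Z -> subspace Z' -> (forall x, B x -> Z' x) ->
    quotient_coords Z Z' delta ->
    quotient_coords Z' B psi -> (forall x, Z' x -> Z x) ->
  exists phi : V -> 'rV[rat]_(r + s), quotient_coords Z B phi.
Proof.
move=> sZ sZ' BZ' dP pP Z'Z; have [dlin dker dsur] := dP.
have [plin pker psur] := pP.
have [z Zz dz] := coords_basis sZ dP.
pose corr x := x - \sum_i delta x 0 i *: z i.
have Zcorr x : Z x -> Z' (corr x).
  move=> Zx; apply/(coords_eqP sZ dP); rewrite ?dz //.
  exact: subspace_sum.
have corr_lin a x y : Z x -> Z y -> corr (a *: x + y) = a *: corr x + corr y.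
  move=> Zx Zy; rewrite /corr dlin // scalerBr scaler_sumr addrACA -opprD.
  rewrite -big_split; congr (_ - _); apply: eq_bigr => i _.
  by rewrite !mxE scalerDl scalerA.
have corrZ' x : Z' x -> corr x = x.
  move=> Z'x; have /dker[_ /(_ Z'x) d0] := Z'Z x Z'x.
  by rewrite /corr d0 big1 ?subr0 // => i _; rewrite mxE scale0r.
exists (fun x => row_mx (delta x) (psi (corr x))); split => [a x y Zx Zy|x Zx|u].
- rewrite dlin // corr_lin // plin; [|exact: Zcorr|exact: Zcorr].
  by rewrite scale_row_mx add_row_mx.
- split => [|Bx].
    rewrite -[0]row_mx0 => /eq_row_mx[/(dker _ Zx) Z'x].
    by rewrite corrZ' // => /pker; exact.
  have Z'x := BZ' x Bx; rewrite corrZ' //.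
  have /dker[_ -> //] := Zx; have /pker[_ -> //] := Z'x.
  by rewrite row_mx0.
- have [x' Z'x' px'] := psur (rsubmx u).
  pose x := x' + \sum_i lsubmx u 0 i *: z i.
  have Zs : Z (\sum_i lsubmx u 0 i *: z i) by exact: subspace_sum.
  have dx : delta x = lsubmx u.
    rewrite /x -[x']scale1r dlin //; last exact: Z'Z.
    have /dker[_ -> //] := Z'Z x' Z'x'.
    by rewrite scaler0 add0r dz.
  exists x; first by rewrite /x -[x']scale1r; apply: (sZ).2 => //; exact: Z'Z.
  by rewrite /corr dx /x addrK px' hsubmxK.
Qed.

End QuotientCoords.

Section Complex.
Variables (C : nat -> lmodType rat) (d : forall k, {linear C k.+1 -> C k}).

Definition is_cycle (k : nat) : C k -> Prop :=
  if k is k'.+1 then fun c => d k' c = 0 else fun=> True.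

Definition is_boundary (k : nat) (c : C k) : Prop := exists e, c = d k e.

(** Same shape as [is_betti], for an arbitrary complex: for singular chains the two notions are
    convertible, which is all that [is_euler_charE] uses. *)
Definition has_betti (k b : nat) : Prop :=
  exists z : 'I_b -> C k, (forall i, is_cycle (z i)) /\
    forall c, is_cycle c ->
      exists! a : 'rV[rat]_b,
        exists e : C k.+1, c - \sum_i a 0 i *: z i = d k e.

Definition has_finite_homology : Prop :=
  exists (b : nat -> nat) (N : nat), (forall k, has_betti k (b k)) /\
    forall k, (N <= k)%N -> b k = 0%N.

Definition has_euler_char (chi : int) : Prop :=
  exists (b : nat -> nat) (N : nat),
    [/\ forall k, has_betti k (b k),
        forall k, (N <= k)%N -> b k = 0%N
      & chi = \sum_(k < N) (-1) ^+ k * (b k)%:Z].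

Lemma subspace_cycle k : subspace (@is_cycle k).
Proof.
case: k => [|k]; first by [].
split => /= [|a x y dx dy]; first by rewrite linear0.
by rewrite linearP dx dy scaler0 addr0.
Qed.

Lemma boundary0 k : @is_boundary k 0.
Proof. by exists 0; rewrite linear0. Qed.

Lemma has_bettiP k b :
  has_betti k b <->
  exists phi : C k -> 'rV[rat]_b, quotient_coords (@is_cycle k) (@is_boundary k) phi.
Proof.
split => [[z [zc zgen]]|[phi phiP]].
  apply: (@coords_of_relation _ _ _ _
    (fun c a => exists e, c - \sum_i a 0 i *: z i = d k e)).
  - exact: subspace_cycle.
  - exact: boundary0.
  - move=> a x u y v [e xe] [f yf]; exists (a *: e + f).
    rewrite linearP -xe -yf scalerBr scaler_sumr addrACA -opprD -big_split.
    by congr (_ - _); apply: eq_bigr => i _; rewrite !mxE scalerDl scalerA.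
  - by move=> x /zgen[a [ha _]]; exists a.
  - move=> x u /zgen[a [_ au]] xu; split => [u0|[e xe]].
      move: xu => [e]; rewrite u0 big1 ?subr0 => [xe|i _]; first by exists e.
      by rewrite mxE scale0r.
    rewrite -(au _ xu); apply: au; exists e.
    by rewrite big1 ?subr0 // => i _; rewrite mxE scale0r.
  - move=> u; exists (\sum_i u 0 i *: z i).
      exact: subspace_sum (subspace_cycle k) zc.
    by exists 0; rewrite subrr linear0.
have [z zc zP] := coords_basis (subspace_cycle k) phiP.
exists z; split=> // c cc.
have main (a : 'rV[rat]_b) : (exists e, c - \sum_i a 0 i *: z i = d k e) <-> phi c = a.
  have := coords_eqP (subspace_cycle k) phiP cc
    (subspace_sum (index_enum _) (a 0) (subspace_cycle k) zc).
  by rewrite zP => ->.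
by exists (phi c); split => [|a /main //]; apply/main.
Qed.

End Complex.

(** * The long exact sequence of [0 -> A -> A -> B -> 0] *)

Section ShortExactSequence.
Variables (A B : nat -> lmodType rat).
Variables (dA : forall k, {linear A k.+1 -> A k}).
Variables (dB : forall k, {linear B k.+1 -> B k}).
Variables (f : forall k, {linear A k -> A k}) (p : forall k, {linear A k -> B k}).
Hypothesis dAdA : forall k x, dA k (dA k.+1 x) = 0.
Hypothesis fd : forall k x, f k (dA k x) = dA k (f k.+1 x).
Hypothesis pd : forall k x, p k (dA k x) = dB k (p k.+1 x).
Hypothesis f_inj : forall k x, f k x = 0 -> x = 0.
Hypothesis p_sur : forall k y, exists x, p k x = y.
Hypothesis p_ker : forall k x, p k x = 0 <-> exists y, x = f k y.

Let ZA k := @is_cycle A dA k.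
Let BA k := @is_boundary A dA k.
Let ZB k := @is_cycle B dB k.
Let BB k := @is_boundary B dB k.

Lemma cycle_boundary k x : ZA (dA k x).
Proof. by rewrite /ZA; case: k x => //= k x; exact: dAdA. Qed.

Lemma cycle_f k x : ZA (f k x) <-> ZA x.
Proof.
case: k x => [//|k] x /=; rewrite /ZA /= -fd; split => [/f_inj//|->].
by rewrite linear0.
Qed.

Lemma cycle_p k x : ZA x -> ZB (p k x).
Proof.
by case: k x => [//|k] x /=; rewrite /ZA /ZB /= -pd => ->; rewrite linear0.
Qed.

Lemma pf0 k x : p k (f k x) = 0.
Proof. by apply/p_ker; exists x. Qed.

(** [M] is the matrix, acting on rows, of the endomorphism of [H_k(A)] induced by [f]. *)
Lemma coords_induced_mx k b (phi : A k -> 'rV[rat]_b) :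
  quotient_coords (@ZA k) (@BA k) phi ->
  exists M : 'M[rat]_b, forall x, ZA x -> phi (f k x) = phi x *m M.
Proof.
move=> phiP; have sZ := subspace_cycle dA k.
have [z zc zP] := coords_basis sZ phiP.
exists (\matrix_i phi (f k (z i))) => x Zx.
have Zs : ZA (\sum_i phi x 0 i *: z i) by exact: subspace_sum.
have /(coords_eqP sZ phiP Zx Zs)[e xe] : phi x = phi (\sum_i phi x 0 i *: z i).
  by rewrite zP.
have Zf y : ZA y -> ZA (f k y) by move=> /cycle_f.
have -> : phi (f k x) = phi (f k (\sum_i phi x 0 i *: z i)).
  apply/(coords_eqP sZ phiP); [exact: Zf|exact: Zf|].
  by exists (f k.+1 e); rewrite -fd -xe linearB.
rewrite linear_sum mulmx_sum_row; under eq_bigr do rewrite linearZ /=.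
rewrite (coords_sum sZ phiP) => [|i]; last exact: Zf (zc i).
by apply: eq_bigr => i _; rewrite rowK.
Qed.

(** Cycles of [B] that lift to cycles of [A]. They represent the image of [H_k(A)] in [H_k(B)],
    which by exactness is the kernel of the connecting map. *)
Let Z'B k (c : B k) := exists2 e : A k, ZA e & p k e = c.

Lemma subspace_Z'B k : subspace (@Z'B k).
Proof.
split; first by exists 0; [exact: (subspace_cycle dA k).1|rewrite linear0].
move=> a x y [e Ze <-] [e' Ze' <-]; exists (a *: e + e').
  exact: (subspace_cycle dA k).2.
by rewrite linearP.
Qed.

(** Exactness at [H_k(A)]: the image of [H_k(A)] in [H_k(B)] is the cokernel of [M]. A class is read
    off any lift [e] that is a cycle; changing the lift moves [phi e] inside the row space of [M],
    which [K] kills. *)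
Lemma coker_coords k b (phi : A k -> 'rV[rat]_b) (M : 'M[rat]_b) :
  quotient_coords (@ZA k) (@BA k) phi ->
  (forall x, ZA x -> phi (f k x) = phi x *m M) ->
  exists psi : B k -> 'rV[rat]_(b - \rank M), quotient_coords (@Z'B k) (@BB k) psi.
Proof.
move=> phiP fM; have sZ := subspace_cycle dA k; have [lin ker sur] := phiP.
rewrite -mxrank_coker; set K := col_base (cokermx M).
have KP (u : 'rV_b) : u *m K = 0 <-> (u <= M)%MS.
  have -> : (u <= M)%MS = (u *m K *m row_base (cokermx M) == 0).
    by rewrite submxE -mulmxA mulmx_base.
  split => [->|/eqP uK0]; first by rewrite mul0mx.
  by apply: (row_free_inj (row_base_free (cokermx M))); rewrite uK0 mul0mx.
apply: (@coords_of_relation _ _ _ _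
  (fun c u => exists e, [/\ ZA e, p k e = c & u = phi e *m K])).
- exact: subspace_Z'B.
- exact: boundary0.
- move=> a x u y v [e [Ze <- ->]] [e' [Ze' <- ->]]; exists (a *: e + e').
  by split; [exact: sZ.2|rewrite linearP|rewrite lin // mulmxDl scalemxAl].
- by move=> c [e Ze pe]; exists (phi e *m K), e.
- move=> c u _ [e [Ze <- ->]]; rewrite KP; split => [/submxP[v ev]|[b0 eb]].
    have [h Zh hv] := sur v.
    have Zfh : ZA (f k h) by apply/cycle_f.
    have /(coords_eqP sZ phiP Ze Zfh)[x xe] : phi e = phi (f k h).
      by rewrite fM // hv.
    exists (p k.+1 x); rewrite -pd -xe linearB /=.
    by rewrite pf0 subr0.
  have [x px] := p_sur b0.
  have /p_ker[h hx] : p k (e - dA k x) = 0 by rewrite linearB /= eb pd px subrr.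
  have Zh : ZA h.
    by apply/cycle_f; rewrite -hx; apply: subspaceB => //; exact: cycle_boundary.
  rewrite (_ : phi e = phi h *m M) ?submxMl // -fM //.
  apply/(coords_eqP sZ phiP) => //; first exact/cycle_f.
  by exists x; rewrite -hx opprB addrC subrK.
- move=> u; have [v vu] : exists v, v *m K = u.
    have /row_fullP[L LK] := col_base_full (cokermx M).
    by exists (u *m L); rewrite -mulmxA LK mulmx1.
  by have [e Ze ev] := sur v; exists (p k e); exists e; rewrite ?ev.
Qed.

(** The connecting map lifts a cycle [c] to [e] and sends it to the class of [y], where
    [dA e = f y]. Its image is the kernel of [M]; as [M] is square, this has the same dimension as
    the cokernel in [coker_coords]. *)
Lemma connecting_coords k b (phi : A k -> 'rV[rat]_b) (M : 'M[rat]_b) :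
  quotient_coords (@ZA k) (@BA k) phi ->
  (forall x, ZA x -> phi (f k x) = phi x *m M) ->
  exists delta : B k.+1 -> 'rV[rat]_(b - \rank M),
    quotient_coords (@ZB k.+1) (@Z'B k.+1) delta.
Proof.
move=> phiP fM; have sZ := subspace_cycle dA k; have [lin ker sur] := phiP.
have lift c : ZB c -> exists e y,
    [/\ p k.+1 e = c, dA k e = f k y & ZA y].
  move=> Zc; have [e ec] := p_sur c; exists e.
  have /p_ker[y ye] : p k (dA k e) = 0 by rewrite pd ec.
  by exists y; split=> //; apply/cycle_f; rewrite -ye; exact: cycle_boundary.
have /choice[phi' phi'P] c : exists u, ZB c ->
    exists e y, [/\ p k.+1 e = c, dA k e = f k y, ZA y & u = phi y].
  have [Zc|nZc] := pselect (ZB c); last by exists 0.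
  by have [e [y [ec ye Zy]]] := lift c Zc; exists (phi y) => _; exists e, y.
have phi'E c e y : ZB c -> p k.+1 e = c -> dA k e = f k y -> ZA y -> phi' c = phi y.
  move=> Zc ec ye Zy; have [e1 [y1 [e1c y1e Zy1 ->]]] := phi'P c Zc.
  apply/(coords_eqP sZ phiP) => //.
  have /p_ker[h he] : p k.+1 (e1 - e) = 0 by rewrite linearB /= ec e1c subrr.
  exists h; apply/eqP; rewrite -subr_eq0; apply/eqP/f_inj.
  by rewrite !linearB /= fd -he linearB /= y1e ye subrr.
apply: (coords_kermx (phi := phi')) => [a x y Zx Zy|x Zx|u].
- have [e [z [ex ez Zz ->]]] := phi'P x Zx.
  have [e' [z' [e'y e'z' Zz' ->]]] := phi'P y Zy.
  rewrite -lin //; apply: (phi'E _ (a *: e + e')).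
  + exact: (subspace_cycle dB k.+1).2.
  + by rewrite linearP ex e'y.
  + by rewrite !linearP ez e'z'.
  + exact: sZ.2.
- have [e [y [ex ey Zy ->]]] := phi'P x Zx; rewrite ker //; split.
    move=> [y' yy']; exists (e - f k.+1 y').
      by rewrite /ZA /= linearB /= -fd ey yy' subrr.
    by rewrite linearB /= pf0 subr0.
  move=> [e' Ze' e'x].
  have /p_ker[h he] : p k.+1 (e - e') = 0 by rewrite linearB /= ex e'x subrr.
  exists h; apply/eqP; rewrite -subr_eq0; apply/eqP/f_inj.
  by rewrite linearB /= fd -he linearB /= -ey (Ze' : dA k e' = 0) subr0 subrr.
- split => [[x Zx <-]|uM].
    have [e [y [ex ey Zy ->]]] := phi'P x Zx; rewrite -fM //.
    by apply/ker; [exact/cycle_f|exists e].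
  have [y Zy yu] := sur u.
  have [e ye] : BA (f k y).
    by apply/ker; [exact/cycle_f|rewrite fM // yu].
  have Zpe : ZB (p k.+1 e) by rewrite /ZB /= -pd -ye pf0.
  by exists (p k.+1 e) => //; rewrite (phi'E _ e y).
Qed.

(** With [c k] the corank of [M] in degree [k], the two preceding lemmas give
    [b_k(B) = c (k - 1) + c k], and the alternating sum telescopes. *)
Lemma euler_char_coker :
  has_finite_homology dA -> has_euler_char dB 0.
Proof.
move=> [a [N [aP aN]]].
have /choice[c cP] k : exists c, [/\ (N <= k)%N -> c = 0%N,
    exists psi : B k -> 'rV[rat]_c, quotient_coords (@Z'B k) (@BB k) psi &
    exists delta : B k.+1 -> 'rV[rat]_c,
      quotient_coords (@ZB k.+1) (@Z'B k.+1) delta].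
  have /has_bettiP[phi phiP] := aP k.
  have [M fM] := coords_induced_mx phiP.
  exists (a k - \rank M)%N; split.
  - by move=> Nk; apply/eqP; rewrite -leqn0 (leq_trans (leq_subr _ _)) // aN.
  - exact: coker_coords phiP fM.
  - exact: connecting_coords phiP fM.
(* The shifted sequence, with [0] for the absent degree [-1]. The bound becomes [N.+1] because
   degree [N] still receives [c (N - 1)]. *)
pose c' k := if k is k'.+1 then c k' else 0%N.
exists (fun k => c' k + c k)%N, N.+1; split => [k|[//|k] Nk|].
- apply/has_bettiP; case: k => [|k].
    have [_ [psi psiP] _] := cP 0%N; exists psi.
    have [lin ker sur] := psiP.
    have tot x : Z'B (x : B 0%N) by have [e ex] := p_sur x; exists e.
    split => [? ? ? _ _|? _|u]; [exact: lin|exact: ker|].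
    by have [x _ xu] := sur u; exists x.
  have [_ [psi psiP] _] := cP k.+1; have [_ _ [delta deltaP]] := cP k.
  apply: (coords_extension _ _ _ deltaP psiP).
  + exact: subspace_cycle.
  + exact: subspace_Z'B.
  + move=> x [b ->]; have [e <-] := p_sur b; exists (dA k.+1 e).
      exact: cycle_boundary.
    by rewrite pd.
  + by move=> x [e Ze <-]; exact: cycle_p.
- by have [c0 _ _] := cP k; have [c1 _ _] := cP k.+1; rewrite /= c0 ?c1 // ltnW.
- suff -> : \sum_(k < N.+1) (-1) ^+ k * (c' k + c k)%:Z = (-1) ^+ N * (c N)%:Z.
    by have [-> // _ _] := cP N; rewrite mulr0.
  elim: N {aN cP} => [|N IH]; first by rewrite big_ord_recr big_ord0 /= add0r.
  by rewrite big_ord_recr IH /= PoszD mulrDr addrA exprS mulN1r mulNr subrr add0r.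
Qed.

End ShortExactSequence.

(** * Free chains on semi-simplicial sets *)

Section LinearLift.
Variables (K : choiceType) (M : lmodType rat) (f : K -> M).

Definition linear_lift (c : {freeg K / rat}) : M := fglift f c.

Lemma linear_lift_is_additive : zmod_morphism linear_lift.
Proof. exact: lift_is_additive. Qed.

HB.instance Definition _ :=
  GRing.isZmodMorphism.Build {freeg K / rat} M linear_lift linear_lift_is_additive.

Lemma linear_liftU (a : rat) x : linear_lift << a *g x >> = a *: f x.
Proof. exact: liftU. Qed.

Lemma freegZU (a b : rat) (x : K) : a *: << b *g x >> = << a * b *g x >>.
Proof. by apply/eqP/freeg_eqP => t; rewrite coeffZ !coeffU mulrA. Qed.

Lemma linear_lift_is_scalable : scalable linear_lift.
Proof.
move=> a c; rewrite -[in LHS](freeg_sumE c) scaler_sumr raddf_sum /=.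
rewrite -[in RHS](freeg_sumE c) raddf_sum scaler_sumr; apply: eq_bigr => s _.
by rewrite freegZU linear_liftU -scalerA; congr (_ *: _); rewrite [RHS]linear_liftU.
Qed.

HB.instance Definition _ :=
  GRing.isScalable.Build rat {freeg K / rat} M *:%R linear_lift linear_lift_is_scalable.

Lemma freeg_linear_ext (g h : {linear {freeg K / rat} -> M}) :
  (forall x, g << x >> = h << x >>) -> g =1 h.
Proof.
move=> gh c; rewrite -(freeg_sumE c) !linear_sum; apply: eq_bigr => x _.
by rewrite -[coeff x c]mulr1 -freegZU !linearZ /= gh.
Qed.

End LinearLift.

Definition freeg_map (K K' : choiceType) (f : K -> K') :
    {linear {freeg K / rat} -> {freeg K' / rat}} :=
  linear_lift (fun x => << f x >> : {freeg K' / rat}).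

Lemma freeg_mapU (K K' : choiceType) (f : K -> K') (a : rat) x :
  freeg_map f << a *g x >> = << a *g f x >>.
Proof. by rewrite /= linear_liftU freegZU mulr1. Qed.

Section SimplicialChains.
Variables (S : nat -> choiceType) (face : forall k, 'I_k.+2 -> S k.+1 -> S k).

Definition sschain (k : nat) : lmodType rat := {freeg (S k) / rat}.

Definition ssboundary (k : nat) : {linear sschain k.+1 -> sschain k} :=
  linear_lift (fun s => \sum_(i < k.+2) << (-1) ^+ i *g face i s >>).

Lemma ssboundaryU k (s : S k.+1) :
  ssboundary k << s >> = \sum_(i < k.+2) << (-1) ^+ i *g face i s >>.
Proof. by rewrite /= linear_liftU scale1r. Qed.

(** The face relation [d_i d_l = d_(l-1) d_i] for [i < l], with [l = j + 1], so that [i] and [j]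
    have the same type. *)
Definition simplicial_identity : Prop :=
  forall k (s : S k.+2) (i j : 'I_k.+2), (i <= j)%N ->
    face i (face (fintype.lift ord0 j) s) = face j (face (widen_ord (leqnSn _) i) s).

(** The terms at [(i, j + 1)] and [(j, i)] cancel for [i <= j]. With plain naturals as indices, the
    induction adds a last row and a last column without casts between ordinals. *)
Lemma alternating_sum_eq0 (V : zmodType) (F : nat -> nat -> V) N :
  (forall i j, (i <= j < N)%N -> F i j.+1 = F j i) ->
  \sum_(i < N) \sum_(j < N.+1) F i j *~ (-1) ^+ (i + j) = 0.
Proof.
elim: N => [|N IH] FE; first by rewrite big_ord0.
rewrite big_ord_recr /=; under eq_bigr do rewrite big_ord_recr /=.
rewrite big_split /= IH => [|i j /andP[ij jN]]; last first.
  by apply: FE; rewrite ij ltnW.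
rewrite add0r 2!big_ord_recr /= !addrA.
rewrite -[X in X + _ + _]big_split /= big1 => [|i _]; last first.
  rewrite FE ?ltnSn ?andbT 1?ltnW // addnS exprS mulN1r mulrNz addnC.
  by rewrite addNr.
by rewrite add0r FE ?leqnn //= addnS exprS mulN1r mulrNz subrr.
Qed.

Lemma ssboundaryK : simplicial_identity ->
  forall k c, ssboundary k (ssboundary k.+1 c) = 0.
Proof.
move=> sid k c.
pose z : {linear sschain k.+2 -> sschain k} := \0.
rewrite -[RHS]/(z c); move: c.
apply: (freeg_linear_ext (g := ssboundary k \o ssboundary k.+1)) => s.
rewrite /= linear_liftU scale1r linear_sum /=.
under eq_bigr do rewrite linear_liftU scaler_sumr.
rewrite exchange_big /=.
pose F i j : sschain k := << face (inord i) (face (inord j) s) >>.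
rewrite -[RHS](@alternating_sum_eq0 _ F k.+2) => [|i j /andP[ij jk]].
  apply: eq_bigr => i _; apply: eq_bigr => j _.
  rewrite /F !inord_val freegZU addnC exprD -scaler_int [RHS]freegZU mulr1.
  by rewrite rmorphM /= !rmorphXn /= rmorphN1.
have ik : (i < k.+2)%N by exact: leq_ltn_trans jk.
have e1 : inord j.+1 = fintype.lift ord0 (Ordinal jk) :> 'I_k.+3.
  by apply: val_inj; rewrite /= inordK.
have e2 : inord i = Ordinal ik by apply: val_inj; rewrite /= inordK.
have e3 : inord i = widen_ord (leqnSn _) (Ordinal ik) :> 'I_k.+3.
  by apply: val_inj; rewrite /= inordK // ltnW.
have e4 : inord j = Ordinal jk by apply: val_inj; rewrite /= inordK.
by rewrite /F e1 e2 e3 e4 sid.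
Qed.

End SimplicialChains.

Lemma freeg_map_boundary (S T : nat -> choiceType) fS fT
    (p : forall k, S k -> T k) :
  (forall k (i : 'I_k.+2) x, p k (fS k i x) = fT k i (p k.+1 x)) ->
  forall k c, freeg_map (p k) (ssboundary fS k c) =
              ssboundary fT k (freeg_map (p k.+1) c).
Proof.
move=> pf k; apply: (freeg_linear_ext (g := freeg_map (p k) \o ssboundary fS k)
  (h := ssboundary fT k \o freeg_map (p k.+1))) => s.
rewrite /= !linear_liftU !scale1r linear_sum /= linear_liftU scale1r.
by apply: eq_bigr => i _; rewrite linear_liftU freegZU mulr1 pf.
Qed.

(** * Free quotients of semi-simplicial sets *)

Section InfiniteCyclicQuotient.
Variables (S T : nat -> choiceType).
Variables (fS : forall k, 'I_k.+2 -> S k.+1 -> S k).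
Variables (fT : forall k, 'I_k.+2 -> T k.+1 -> T k).
Variables (t : forall k, S k -> S k) (p : forall k, S k -> T k).
Hypothesis fS_id : simplicial_identity fS.
Hypothesis tf : forall k (i : 'I_k.+2) x, t (fS i x) = fS i (t x).
Hypothesis pf : forall k (i : 'I_k.+2) x, p (fS i x) = fT i (p x).
Hypothesis t_inj : forall k, injective (@t k).
Hypothesis t_free : forall k (x : S k) n, iter n.+1 (@t k) x <> x.
Hypothesis p_sur : forall k (y : T k), exists x, p x = y.
Hypothesis p_fib : forall k (x y : S k),
  p x = p y <-> exists n, y = iter n (@t k) x \/ x = iter n (@t k) y.

Let D k : {linear sschain S k -> sschain S k} := freeg_map (@t k) \- idfun.

(** A chain fixed by [t] has constant coefficients along the orbits of [t]. These orbits are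
    infinite and the support is finite, so the chain is [0]. *)
Lemma sub_translate_inj k c : D k c = 0 -> c = 0.
Proof.
move=> /eqP; rewrite subr_eq0 => /eqP tc0.
have {tc0} tc : freeg_map (@t k) c = c := tc0.
apply/eqP; rewrite -dom_eq0.
have coeff_t x : coeff (t x) c = coeff x c.
  rewrite -[in LHS]tc -[in LHS](freeg_sumE c) -[in RHS](freeg_sumE c).
  rewrite linear_sum !raddf_sum; apply: eq_bigr => y _.
  by rewrite freeg_mapU /= !coeffU (inj_eq (@t_inj k)).
case E: (dom c) => [//|x s]; exfalso.
have inj_iter n : injective (iter n (@t k)).
  by elim: n => [//|n IH] u v /= /t_inj/IH.
pose r := [seq iter i (@t k) x | i <- iota 0 (size (dom c)).+1].
have : uniq r.
  rewrite map_inj_uniq ?iota_uniq // => i j.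
  wlog ij : i j / (i < j)%N.
    move=> H; have [/H//|/H e /esym/e //|//] := ltngtP i j.
  rewrite -(subnKC ij) addSnnS iterD => /inj_iter/esym.
  by move=> /t_free.
suff rc : {subset r <= dom c}.
  by move=> /uniq_leq_size/(_ rc); rewrite size_map size_iota ltnn.
move=> y /mapP[i _ ->]; rewrite mem_dom; elim: i => [|i IH] /=.
  by rewrite -mem_dom E mem_head.
by rewrite coeff_t.
Qed.

Lemma fiber_sub_translate k (x y : S k) :
  p x = p y -> exists c, << y >> - << x >> = D k c.
Proof.
have h n (z : S k) : exists c, << iter n (@t k) z >> - << z >> = D k c.
  elim: n => [|n [c e]]; first by exists 0; rewrite subrr linear0.
  exists (c + << iter n (@t k) z >>); rewrite linearD -e.
  have -> : D k << iter n (@t k) z >> = << iter n.+1 (@t k) z >> - << iter n (@t k) z >>.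
    by congr (_ - _); exact: freeg_mapU.
  by rewrite [RHS]addrC addrA subrK.
move=> /p_fib[n [->|->]]; first exact: h.
by have [c e] := h n y; exists (- c); rewrite linearN -e opprB.
Qed.

(** For a section [s] of [p], each [x - s (p x)] is a difference within one orbit, hence in the
    image of [D]. By linearity [c] minus the image of [p c] under [s] is in that image too, and the
    subtracted term vanishes when [p c = 0]. *)
Lemma freeg_map_ker k (c : sschain S k) :
  freeg_map (@p k) c = 0 <-> exists b, c = D k b.
Proof.
split => [pc|[b ->]].
  have /choice[s sP] := @p_sur k.
  have /choice[y yP] x : exists y, << x >> - << s (p x) >> = D k y.
    by apply: fiber_sub_translate; rewrite sP.
  pose P := linear_lift y; exists (P c).
  pose Q := freeg_map s \o freeg_map (@p k).
  suff -> : D k (P c) = c - Q c by rewrite /Q /= pc linear0 subr0.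
  move: c {pc}; apply: (freeg_linear_ext (g := D k \o linear_lift y)
    (h := idfun \- Q)) => x.
  rewrite -[LHS]/(D k (linear_lift y << x >>)) linear_liftU scale1r -yP; congr (_ - _).
  by rewrite -[RHS]/(freeg_map s (freeg_map (@p k) << x >>)) !freeg_mapU.
rewrite -[D k b]/(freeg_map (@t k) b - b) linearB.
apply/eqP; rewrite subr_eq0; apply/eqP; move: b.
apply: (freeg_linear_ext (g := freeg_map (@p k) \o freeg_map (@t k))) => x.
rewrite -[LHS]/(freeg_map (@p k) (freeg_map (@t k) << x >>)) !freeg_mapU.
congr (<< _ >>); apply/p_fib.
by exists 1%N; right.
Qed.

(* [0 -> C(S) --(t - 1)--> C(S) -> C(T) -> 0] is exact. *)
Lemma infinite_cyclic_quotient_euler_char :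
  has_finite_homology (ssboundary fS) -> has_euler_char (ssboundary fT) 0.
Proof.
apply: (@euler_char_coker _ _ _ _ D (fun k => freeg_map (@p k))).
- exact: ssboundaryK.
- move=> k c; rewrite -[D k.+1 c]/(freeg_map (@t _) c - c) linearB.
  by rewrite -(freeg_map_boundary tf).
- exact: freeg_map_boundary pf.
- exact: sub_translate_inj.
- move=> k y; have /choice[s sP] := @p_sur k.
  exists (freeg_map s y); move: y.
  apply: (freeg_linear_ext (g := freeg_map (@p k) \o freeg_map s) (h := idfun)).
  move=> x; rewrite -[LHS]/(freeg_map (@p k) (freeg_map s << x >>)).
  by rewrite !freeg_mapU sP.
- exact: freeg_map_ker.
Qed.

End InfiniteCyclicQuotient.

(** * Choice of representatives for an equivalence relation *)

Section QuotientType.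
Local Open Scope quotient_scope.
Variables (K : choiceType) (r : K -> K -> Prop).
Hypotheses (r_refl : forall x, r x x) (r_sym : forall x y, r x y -> r y x).
Hypothesis r_trans : forall x y z, r x y -> r y z -> r x z.

Let e : rel K := fun x y => `[< r x y >].

Let e_refl : reflexive e. Proof. by move=> x; apply/asboolP. Qed.

Let e_sym : symmetric e.
Proof. by move=> x y; apply/asboolP/asboolP; exact: r_sym. Qed.

Let e_trans : transitive e.
Proof. by move=> y x z /asboolP xy /asboolP yz; apply/asboolP/(r_trans xy). Qed.

Lemma quotient_choiceType : exists (Q : choiceType) (pi : K -> Q) (sec : Q -> K),
  cancel sec pi /\ forall x y, pi x = pi y <-> r x y.
Proof.
pose E := EquivRel e e_refl e_sym e_trans.
exists {eq_quot E}, \pi_{eq_quot E}, (@generic_quotient.repr _ {eq_quot E}).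
split=> [u|x y]; first by rewrite generic_quotient.reprK.
by split=> [/eqmodP/asboolP|xy]; [|apply/eqmodP/asboolP].
Qed.

End QuotientType.

(** * Quotients by a free action of [Z^n] *)

Section FreeAbelianQuotient.
Variables (S : nat -> choiceType).
Variables (fS : forall k, 'I_k.+2 -> S k.+1 -> S k).
Variables (n : nat) (act : forall k, 'cV[int]_n -> S k -> S k).
Hypothesis fS_id : simplicial_identity fS.
Hypothesis fS_fin : has_finite_homology (ssboundary fS).
Hypothesis act0 : forall k (x : S k), act 0 x = x.
Hypothesis actD : forall k z z' (x : S k), act (z + z') x = act z (act z' x).
Hypothesis act_free : forall k z (x : S k), act z x = x -> z = 0.
Hypothesis act_face : forall k (i : 'I_k.+2) z x, act z (fS i x) = fS i (act z x).

Let supp_lt (j : nat) (z : 'cV[int]_n) := forall i : 'I_n, (j <= i)%N -> z i 0 = 0.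

Let supp_ltB j z z' : supp_lt j z -> supp_lt j z' -> supp_lt j (z - z').
Proof. by move=> hz hz' i ji; rewrite !mxE hz // hz' // subrr. Qed.

Let supp_lt0 j : supp_lt j 0. Proof. by move=> i _; rewrite mxE. Qed.

Let iter_act k z m (x : S k) : iter m (act z) x = act (z *+ m) x.
Proof. by elim: m => [|m IH] /=; rewrite ?act0 // IH mulrS actD. Qed.

Let actK k z (x : S k) : act (- z) (act z x) = x.
Proof. by rewrite -actD addNr act0. Qed.

(** Induction on the number of coordinates divided out. The quotient [T] is quantified so that the
    hypothesis applies to an auxiliary one. The base case already divides by one generator: the
    trivial subgroup gives [S] back, whose Euler characteristic need not be [0]. *)
Lemma partial_free_quotient_euler_char j : (j < n)%N ->
  forall (T : nat -> choiceType) (fT : forall k, 'I_k.+2 -> T k.+1 -> T k)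
    (p : forall k, S k -> T k),
  (forall k (i : 'I_k.+2) x, p k (fS i x) = fT k i (p k.+1 x)) ->
  (forall k (y : T k), exists x, p k x = y) ->
  (forall k (x y : S k),
     p k x = p k y <-> exists2 z, supp_lt j.+1 z & y = act z x) ->
  has_euler_char (ssboundary fT) 0.
Proof.
elim: j => [|j IH] jn T fT p pf p_sur p_fib.
  pose z0 : 'cV[int]_n := delta_mx (Ordinal jn) 0.
  have z0E z : supp_lt 1 z -> z = z0 *~ z (Ordinal jn) 0.
    move=> hz; apply/colP => i; rewrite -scaler_int !mxE eqxx andbT.
    have [->|] := eqVneq i (Ordinal jn); first by rewrite mulr1 intz.
    by rewrite -val_eqE /= -lt0n mulr0 => /hz.
  have z0P m : supp_lt 1 (z0 *~ m).
    move=> i i0; rewrite -scaler_int !mxE eqxx andbT -val_eqE /=.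
    by rewrite gtn_eqF // mulr0.
  apply: (infinite_cyclic_quotient_euler_char (t := fun k => @act k z0)
    (p := p) fS_id _ pf _ _ p_sur _ fS_fin).
  - by move=> k i x; exact: act_face.
  - by move=> k x y e; rewrite -[x](actK z0) e actK.
  - move=> k x m; rewrite iter_act => /act_free/matrixP/(_ (Ordinal jn) 0).
    by move=> /eqP; rewrite mulmxnE !mxE !eqxx /= mulrn_eq0.
  - move=> k x y; rewrite p_fib; split => [[z /z0E -> ->]|[m]].
      case: (z _ _) => m; first by exists m; left; rewrite iter_act.
      by exists m.+1; right; rewrite iter_act NegzE mulrNz -actD subrr act0.
    rewrite !iter_act => -[->|->]; first by exists (z0 *+ m) => //; exact: (z0P m).
    exists (- (z0 *+ m)); last by rewrite actK.
    by have := z0P (- m%:Z); rewrite mulrNz.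
(* [U] will be the quotient of [S] by the first [j + 1] coordinates. The induction hypothesis makes
   its homology finite, and [T] is the quotient of [U] by the single translation [t] along the next
   basis vector [z0]. *)
pose r k (x y : S k) := exists2 z, supp_lt j.+1 z & y = act z x.
have H k : exists (U : choiceType) (pi : S k -> U) (sec : U -> S k),
    cancel sec pi /\ forall x y, pi x = pi y <-> r k x y.
  apply: quotient_choiceType => [x|x y [z hz ->]|x y w [z hz ->] [z' hz' ->]].
  - by exists 0; rewrite ?act0.
  - by exists (- z); rewrite ?actK // -sub0r; exact: supp_ltB.
  - exists (z' - (0 - z)); first by do 2!apply: supp_ltB => //.
    by rewrite sub0r opprK actD.
pose U k := sval (cid (H k)).
pose pi k : S k -> U k := sval (cid (svalP (cid (H k)))).
pose sec k : U k -> S k := sval (cid (svalP (cid (svalP (cid (H k)))))).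
have [secK piP] : (forall k, cancel (@sec k) (@pi k)) /\
    forall k x y, pi k x = pi k y <-> r k x y.
  by split=> k; have [] := svalP (cid (svalP (cid (svalP (cid (H k)))))).
have pi_sec k x : r k (sec k (pi k x)) x by apply/piP; rewrite secK.
pose fU k (i : 'I_k.+2) (u : U k.+1) : U k := pi k (fS i (sec k.+1 u)).
have fUE k (i : 'I_k.+2) x : pi k (fS i x) = fU k i (pi k.+1 x).
  by apply/esym/piP; have [z hz e] := pi_sec _ x; exists z; rewrite // act_face -e.
pose z0 : 'cV[int]_n := delta_mx (Ordinal jn) 0.
have z0E z : supp_lt j.+2 z -> supp_lt j.+1 (z - z0 *~ z (Ordinal jn) 0).
  move=> hz i ji; rewrite -scaler_int !mxE eqxx andbT.
  have [->|] := eqVneq i (Ordinal jn); first by rewrite mulr1 intz subrr.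
  by rewrite -val_eqE /= => nij; rewrite mulr0 subr0 hz // ltn_neqAle eq_sym nij.
have z0P m : supp_lt j.+2 (z0 *~ m).
  move=> i ji; rewrite -scaler_int !mxE eqxx andbT -val_eqE /=.
  by rewrite gtn_eqF // mulr0.
pose t k (u : U k) : U k := pi k (act z0 (sec k u)).
(* Translation by [z0] descends to [U] because the group is commutative. *)
have tE k x : t k (pi k x) = pi k (act z0 x).
  apply/piP; have [z hz e] := pi_sec _ x; exists z => //.
  by rewrite -actD addrC actD -e.
have iter_t k m x : iter m (t k) (pi k x) = pi k (act (z0 *+ m) x).
  elim: m => [|m IHm] /=; first by rewrite act0.
  by rewrite IHm tE mulrS actD.
have p_sec k x : p k (sec k (pi k x)) = p k x.
  apply/p_fib; have [z hz e] := pi_sec _ x; exists z => // i ji.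
  by apply: hz; rewrite ltnW.
have U_id : simplicial_identity fU.
  move=> k u i i' ii'; rewrite -(secK _ u) -!fUE.
  by congr (pi _ _); exact: fS_id.
apply: (@infinite_cyclic_quotient_euler_char U T fU fT t
    (fun k u => p k (sec k u)) U_id).
- by move=> k i u; rewrite -(secK _ u) -fUE !tE -fUE act_face.
- by move=> k i u; rewrite -(secK _ u) -fUE !p_sec pf.
- move=> k u v; rewrite -(secK _ u) -(secK _ v) !tE => /piP[z hz e].
  apply/piP; exists z => //.
  by rewrite -[sec k v](actK z0) e -!actD addrAC addNr add0r.
(* A periodic point of [t] would give [z0 *+ m.+1 = z] with [z] supported in the earlier
   coordinates; the coordinate of [z0] excludes this. *)
- move=> k u m; rewrite -(secK _ u) iter_t => /esym/piP[z hz] /esym e.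
  have /act_free : act (- z + z0 *+ m.+1) (sec k u) = sec k u.
    by rewrite actD -e actK.
  move=> /matrixP/(_ (Ordinal jn) 0).
  by move=> /eqP; rewrite mxE mulmxnE !mxE hz // oppr0 add0r !eqxx /= mulrn_eq0.
- by move=> k y; have [x <-] := p_sur k y; exists (pi k x); rewrite p_sec.
- move=> k u v; rewrite p_fib; split => [[z hz e]|[m]].
    have h : pi k (act (z0 *~ z (Ordinal jn) 0) (sec k u)) = v.
      rewrite -[RHS]secK e; apply/piP; exists (z - z0 *~ z (Ordinal jn) 0).
        exact: z0E.
      by rewrite -actD subrK.
    move: h; case: (z _ _) => m <-.
      by exists m; left; rewrite -[in RHS](secK _ u) iter_t.
    exists m.+1; right; rewrite iter_t -actD NegzE mulrNz subrr act0.
    by rewrite secK.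
  rewrite -{1}(secK _ u) -{2}(secK _ v) !iter_t.
  have z0m : supp_lt j.+2 (z0 *+ m) by exact: (z0P m).
  have wk z : supp_lt j.+1 z -> supp_lt j.+2 z.
    by move=> hz i ji; apply: hz; rewrite ltnW.
  rewrite -{1}(secK _ v) -{2}(secK _ u).
  case=> [/esym/piP[z hz ->]|/esym/piP[z hz ->]].
    exists (z - (0 - z0 *+ m)); last by rewrite sub0r opprK actD.
    by apply: supp_ltB; [exact: wk|exact: supp_ltB].
  exists (0 - (z0 *+ m) - z); last by rewrite -!actD !subrK act0.
  by apply: supp_ltB; [exact: supp_ltB|exact: wk].
- have [b [N [bP bN _]]] := IH (ltnW jn) U fU pi fUE
    (fun k u => ex_intro _ (sec k u) (secK k u)) piP.
  by exists b, N.
Qed.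

Lemma free_quotient_euler_char (T : nat -> choiceType)
    (fT : forall k, 'I_k.+2 -> T k.+1 -> T k) (p : forall k, S k -> T k) :
  (0 < n)%N ->
  (forall k (i : 'I_k.+2) x, p k (fS i x) = fT k i (p k.+1 x)) ->
  (forall k (y : T k), exists x, p k x = y) ->
  (forall k (x y : S k), p k x = p k y <-> exists z, y = act z x) ->
  has_euler_char (ssboundary fT) 0.
Proof.
move=> n_gt0 pf p_sur p_fib.
have jn : (n.-1 < n)%N by rewrite prednK.
apply: (partial_free_quotient_euler_char jn pf p_sur) => k x y.
rewrite p_fib; split=> [[z ->]|[z _ ->]]; last by exists z.
by exists z => // i; rewrite prednK // leqNgt ltn_ord.
Qed.

End FreeAbelianQuotient.

(** * Singular simplices *)

Lemma coface_row_lift (R : realType) k (i : 'I_k.+2) (x : 'rV[R]_k.+1) j :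
  coface_row i x 0 (fintype.lift i j) = x 0 j.
Proof. by rewrite mxE liftK. Qed.

Lemma coface_row_none (R : realType) k (i : 'I_k.+2) (x : 'rV[R]_k.+1) :
  coface_row i x 0 i = 0.
Proof. by rewrite mxE unlift_none. Qed.

Lemma coface_row_comm (R : realType) k (x : 'rV[R]_k.+1) (i j : 'I_k.+2) :
  (i <= j)%N ->
  coface_row (fintype.lift ord0 j) (coface_row i x) =
  coface_row (widen_ord (leqnSn _) i) (coface_row j x).
Proof.
move=> ij; apply/rowP => l.
have [l1 ->|->] := unliftP (fintype.lift ord0 j) l.
  rewrite coface_row_lift; have [l2 ->|->] := unliftP i l1.
    rewrite coface_row_lift.
    have -> : fintype.lift (fintype.lift ord0 j) (fintype.lift i l2) =
        fintype.lift (widen_ord (leqnSn _) i) (fintype.lift j l2).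
      by apply: val_inj; rewrite /= /bump; lia.
    by rewrite !coface_row_lift.
  rewrite coface_row_none.
  have -> : fintype.lift (fintype.lift ord0 j) i = widen_ord (leqnSn _) i.
    by apply: val_inj; rewrite /= /bump; lia.
  by rewrite coface_row_none.
rewrite coface_row_none.
have -> : fintype.lift ord0 j = fintype.lift (widen_ord (leqnSn _) i) j.
  by apply: val_inj; rewrite /= /bump; lia.
by rewrite coface_row_lift coface_row_none.
Qed.

Lemma face_simplicial_identity (R : realType) (X : topologicalType) :
  simplicial_identity (@face R X).
Proof.
move=> k s i j ij; apply/continuousEP => x /=.
by congr (s _); apply: val_inj; exact: coface_row_comm.
Qed.

Lemma is_euler_charE (R : realType) (X : topologicalType) chi :
  has_euler_char (ssboundary (@face R X)) chi -> is_euler_char R X chi.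
Proof. by []. Qed.

Lemma cvg_set_val (T : Type) (X : topologicalType) (A : set X)
    (F : set_system T) (f : T -> A) (l : A) :
  Filter F -> (set_val \o f) @ F --> (set_val l : X) -> f @ F --> l.
Proof.
move=> FF fl U [_ [[W oW <-] Wl WU]].
have FW : F ((set_val \o f) @^-1` W).
  by apply: fl; apply: open_nbhs_nbhs; split.
by apply: (@filterS _ F FF _ _ _ FW) => x Wx; exact: WU.
Qed.

Lemma cvg_mx_entries (T : Type) (X : topologicalType) m n
    (F : set_system T) (f : T -> 'M[X]_(m, n)) (l : 'M[X]_(m, n)) :
  Filter F -> (forall i j, (fun x => f x i j) @ F --> l i j) -> f @ F --> l.
Proof.
move=> FF fl U [P nP PU].
have near_P i j : F [set x | P i j (f x i j)] by exact: (fl i j _ (nP i j)).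
have FP : F [set x | forall i j, P i j (f x i j)].
  apply: (@filter_forall _ _ (fun i => _) _ FF) => i.
  by apply: (@filter_forall _ _ (fun j x => _) _ FF) => j; exact: near_P.
by apply: (@filterS _ F FF _ _ _ FP) => x Px; exact: PU.
Qed.

(** * Convergence of complex matrices through real and imaginary parts *)

Section ComplexTopology.
Variable R : realType.
Implicit Types z w : Cplx R.

Lemma cplx_ballP z (e : R) w : ball z (e%:C%C : Cplx R) w <->
  Num.sqrt (complex.Re (z - w) ^+ 2 + complex.Im (z - w) ^+ 2) < e.
Proof. by rewrite -ball_normE /= normc_def ltcE /= eqxx. Qed.

Lemma continuous_Re : continuous (@complex.Re R : Cplx R -> R).
Proof.
move=> z U /nbhs_ballP[e /= e0 eU].
apply/nbhs_ballP; exists (e%:C%C : Cplx R); first by rewrite /= ltcE /= eqxx.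
move=> w /cplx_ballP zw; apply: eU; rewrite -ball_normE /=.
apply: le_lt_trans zw; case: z w => [a b] [c d] /=.
by rewrite -(sqrtr_sqr (a - c)) ler_wsqrtr // lerDl sqr_ge0.
Qed.

Lemma continuous_Im : continuous (@complex.Im R : Cplx R -> R).
Proof.
move=> z U /nbhs_ballP[e /= e0 eU].
apply/nbhs_ballP; exists (e%:C%C : Cplx R); first by rewrite /= ltcE /= eqxx.
move=> w /cplx_ballP zw; apply: eU; rewrite -ball_normE /=.
apply: le_lt_trans zw; case: z w => [a b] [c d] /=.
by rewrite -(sqrtr_sqr (b - d)) ler_wsqrtr // lerDr sqr_ge0.
Qed.

Lemma cvg_cplx (T : Type) (F : set_system T) (f : T -> Cplx R) (l : Cplx R) :
  Filter F -> (fun x => complex.Re (f x)) @ F --> complex.Re l ->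
  (fun x => complex.Im (f x)) @ F --> complex.Im l -> f @ F --> l.
Proof.
move=> FF fr fi U /nbhs_ballP[[e e'] /=].
(* The radius of a ball is itself a complex number; being positive, it is real. *)
rewrite ltcE /= => /andP[/eqP -> e0] eU.
have e20 : 0 < e / 2 by rewrite divr_gt0.
have hr : F [set x | `|complex.Re l - complex.Re (f x)| < e / 2].
  by move/cvgrPdist_lt : fr; exact.
have hi : F [set x | `|complex.Im l - complex.Im (f x)| < e / 2].
  by move/cvgrPdist_lt : fi; exact.
apply: (@filterS2 _ F FF _ _ _ _ hr hi) => x /= hx hx'.
apply/eU/cplx_ballP; rewrite -[ltRHS]ger0_norm ?ltW // -sqrtr_sqr ltr_sqrt.
  suff : (complex.Re l - complex.Re (f x)) ^+ 2 +
      (complex.Im l - complex.Im (f x)) ^+ 2 < e ^+ 2.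
    by case: (l) (f x) => [a b] [c d].
  move: hx hx'; rewrite !ltr_norml => /andP[? ?] /andP[? ?]; nra.
by rewrite exprn_gt0.
Qed.

Lemma cvg_cplx_mxP (T : Type) m n (F : set_system T)
    (f : T -> 'M[Cplx R]_(m, n)) (l : 'M[Cplx R]_(m, n)) :
  Filter F ->
  f @ F --> l <-> forall i j,
    (fun x => complex.Re (f x i j)) @ F --> complex.Re (l i j) /\
    (fun x => complex.Im (f x i j)) @ F --> complex.Im (l i j).
Proof.
move=> FF; split => [fl i j|fl]; last first.
  by apply: cvg_mx_entries => i j; have [] := fl i j; exact: cvg_cplx.
have fij : (fun x => f x i j) @ F --> l i j.
  exact: (cvg_comp _ _ fl (@coord_continuous (Cplx R) _ _ i j l)).
split; first exact: (cvg_comp _ _ fij (@continuous_Re (l i j))).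
exact: (cvg_comp _ _ fij (@continuous_Im (l i j))).
Qed.

End ComplexTopology.

(** * Segments, connectedness and compactness in the standard simplex *)

Section Simplex.
Variables (R : realType) (k : nat).
Local Notation K := (std_simplex R k).

Lemma simplex_ge0 (x : K) i : 0 <= set_val x 0 i.
Proof. by have [h _] := set_mem (valP x). Qed.

Lemma simplex_sum (x : K) : \sum_i set_val x 0 i = 1.
Proof. by have [_ h] := set_mem (valP x). Qed.

Lemma simplex_le1 (x : K) i : set_val x 0 i <= 1.
Proof.
rewrite -(simplex_sum x) (bigD1 i) //= lerDl.
by apply: sumr_ge0 => j _; exact: simplex_ge0.
Qed.

Lemma continuous_simplex_coord i : continuous (fun x : K => set_val x 0 i).
Proof.
move=> x; apply: (@continuous_comp _ _ _ set_val (fun y : 'rV[R]_k.+1 => y 0 i)).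
  exact: initial_continuous.
exact: coord_continuous.
Qed.

Lemma cvg_simplex (T : Type) (F : set_system T) (f : T -> K) (l : K) :
  Filter F -> (forall i, (fun x => set_val (f x) 0 i) @ F --> set_val l 0 i) ->
  f @ F --> l.
Proof.
move=> FF fl; apply: cvg_set_val; apply: cvg_mx_entries => i j.
by rewrite (ord1 i); exact: fl.
Qed.

Lemma vertex_subproof : K (delta_mx 0 ord0).
Proof.
split=> [i|]; first by rewrite mxE; case: (_ && _).
rewrite (bigD1 ord0) //= mxE !eqxx big1 ?addr0 // => i /negPf i0.
by rewrite mxE i0 andbF.
Qed.

Definition vertex : K := SigSub (mem_set vertex_subproof).

(** Retracts the line onto the unit interval, so that [segment] takes values in the simplex for
    every real parameter and is continuous on the whole line. *)
Definition clamp (t : R) : R := Num.min (Num.max t 0) 1.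

Lemma clamp_itv t : 0 <= clamp t <= 1.
Proof. by rewrite /clamp le_min ge_min le_max lexx ler01 lexx !orbT. Qed.

Lemma clamp_id t : 0 <= t <= 1 -> clamp t = t.
Proof. by move=> /andP[t0 t1]; rewrite /clamp max_l // min_l. Qed.

Lemma continuous_clamp : continuous clamp.
Proof.
apply: (@min_fun_continuous _ _ _ (fun t : R => Num.max t 0) (cst 1)).
  by apply: (@max_fun_continuous _ _ _ (fun t : R => t) (cst 0)) => x;
    [exact: cvg_id|exact: cvg_cst].
by move=> x; exact: cvg_cst.
Qed.

Definition segment_row (x y : 'rV[R]_k.+1) t := (1 - clamp t) *: x + clamp t *: y.

Lemma segment_simplex (x y : K) t : K (segment_row (set_val x) (set_val y) t).
Proof.
have /andP[t0 t1] := clamp_itv t; split=> [i|].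
  by rewrite !mxE addr_ge0 // mulr_ge0 ?subr_ge0 ?simplex_ge0.
under eq_bigr do rewrite !mxE; rewrite big_split /= -!mulr_sumr !simplex_sum.
by rewrite !mulr1 subrK.
Qed.

Definition segment (x y : K) t : K := SigSub (mem_set (segment_simplex x y t)).

Lemma segment0 x y : segment x y 0 = x.
Proof.
apply: val_inj; rewrite /= /segment_row clamp_id ?lexx ?ler01 //.
by rewrite subr0 scale1r scale0r addr0.
Qed.

Lemma segment1 x y : segment x y 1 = y.
Proof.
apply: val_inj; rewrite /= /segment_row clamp_id ?lexx ?ler01 //.
by rewrite subrr scale1r scale0r add0r.
Qed.

Lemma continuous_segment x y : continuous (segment x y).
Proof.
move=> t; apply: cvg_simplex => i.
under eq_fun do rewrite /= !mxE.
rewrite /= !mxE; apply: cvgD; apply: cvgMl.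
  by apply: cvgB; [exact: cvg_cst|exact: continuous_clamp].
exact: continuous_clamp.
Qed.

Lemma continuous_segmentr x t : continuous (fun y => segment x y t).
Proof.
move=> y; apply: (cvg_simplex (@nbhs_filter _ y)) => i.
under eq_fun do rewrite /= !mxE.
rewrite /= !mxE; apply: cvgD; first exact: cvg_cst.
by apply: cvgMr; exact: continuous_simplex_coord.
Qed.

(** If [f x < f y], the intermediate value theorem on the segment from [x] to [y] yields the value
    [f x + 1/2], which is not an integer. *)
Lemma continuous_int_constant (f : K -> R) :
  continuous f -> (forall x, f x \is a Num.int) -> forall x y, f x = f y.
Proof.
move=> cf fint x y; apply/eqP; apply: contraT.
wlog xy : x y / f x < f y.
  by move=> h; case: ltgtP => // xy _; [apply: (h x y)|apply: (h y x)];
    rewrite // ?lt_eqF ?gt_eqF.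
have /intrP[a ea] := fint x; have /intrP[b eb] := fint y.
have {xy} ab : f x + 1 <= f y.
  by move: xy; rewrite ea eb ltr_int -intrD1 ler_int lezD1.
move=> _; pose g t := f (segment x y t).
have cg : continuous g.
  by move=> t; apply: continuous_comp; [exact: continuous_segment|exact: cf].
have [c _] : exists2 c, c \in `[0, 1] & g c = f x + 2^-1.
  apply: IVT => //; first exact: continuous_subspaceT.
  rewrite /g segment0 segment1.
  by rewrite ge_min le_max; apply/andP; split; apply/orP; [left|right]; lra.
rewrite /g => e; have /intrP[z ez] := fint (segment x y c).
have : (a < z)%R by rewrite -(ltr_int R) -ez -ea e ltrDl invr_gt0.
rewrite -lezD1 -(ler_int R) intrD -ez -ea e.
lra.
Qed.

Lemma compact_simplex : compact [set: K].
Proof.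
have cK : compact (K : set 'rV[R]_k.+1).
  have cube : compact [set v : 'rV[R]_k.+1 | forall i, `[0, 1]%classic (v ord0 i)].
    by apply: (@rV_compact R _ (fun=> `[0, 1]%classic)) => _; exact: segment_compact.
  apply: subclosed_compact cube _.
    rewrite (_ : std_simplex R k =
        (\bigcap_i (fun v : 'rV[R]_k.+1 => v 0 i) @^-1` [set t | 0 <= t]) `&`
        (fun v : 'rV[R]_k.+1 => \sum_i v 0 i) @^-1` [set 1]); last first.
      apply/seteqP; split=> [v [v0 v1]|v [v0 v1]]; split=> // i.
        by move=> _; exact: v0.
      exact: (v0 i I).
    have cl (f : 'rV[R]_k.+1 -> R) (A : set R) :
        continuous f -> closed A -> closed (f @^-1` A).
      by move=> /(@continuous_closedP _ R)/(_ A).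
    apply: closedI.
      apply: closed_bigI => i _; apply: cl; last exact: closed_ge.
      exact: coord_continuous.
    apply: (cl (fun v => \sum_i v 0 i)); last exact: closed_eq.
    by apply: continuous_big => [|i _]; [exact: add_continuous|exact: coord_continuous].
  move=> v Kv i; rewrite /= in_itv /=.
  by rewrite (simplex_ge0 (SigSub (mem_set Kv))) (simplex_le1 (SigSub (mem_set Kv))).
(* Compactness is so far that of a subset of row vectors. It passes to the subtype as the image
   under [r], whose default value outside the simplex is harmless. *)
pose r (v : 'rV[R]_k.+1) : K :=
  if pselect (K v) is left Kv then SigSub (mem_set Kv) else vertex.
have -> : [set: K] = r @` K.
  apply/esym/seteqP; split=> // x _; exists (set_val x); first exact: set_mem (valP x).
  rewrite /r; case: pselect => [Kx|[]]; last exact: set_mem (valP x).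
  exact: val_inj.
apply: continuous_compact => //; apply/subspace_sigL_continuousP.
have -> : sigL K r = id :> (K -> K).
  apply: funext => x; rewrite /sigL /= /r.
  case: pselect => [Kx|[]]; last exact: set_mem (valP x).
  exact: val_inj.
by move=> x; exact: cvg_id.
Qed.

Lemma simplex_bounded (f : K -> R) : continuous f ->
  exists2 M, 0 <= M & forall x, `|f x| <= M.
Proof.
move=> cf; have [c _ cM] : exists2 c, c \in [set: K] &
    forall x, x \in [set: K] -> `|f x| <= `|f c|.
  apply: (@compact_EVT_max _ _ (fun x => `|f x|)).
  - by exists vertex.
  - exact: compact_simplex.
  - apply: continuous_subspaceT => x; exact: (cvg_norm (cf x)).
by exists `|f c| => // x; apply: cM; rewrite inE.
Qed.

(** Uniform continuity for the tolerance [1], as used to cut paths on the circle. If [f] varies by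
    less than [1/2] from [f x] within distance [e], then any [x'] within [e/2] of [x] and any [y]
    within [d < e/2] of [x'] both qualify; compactness makes [d] uniform. *)
Lemma simplex_uniform (f : K -> R) : continuous f ->
  exists2 d, 0 < d & forall x y : K,
    (forall i, `|set_val x 0 i - set_val y 0 i| < d) -> `|f x - f y| < 1.
Proof.
move=> cf; have /compact_near_coveringP := compact_simplex.
pose P (d : R) (x : K) := forall y : K,
  (forall i, `|set_val x 0 i - set_val y 0 i| < d) -> `|f x - f y| < 1.
move=> /(_ R (0^'+) P) h.
have {h} : \forall d \near 0^'+, [set: K] `<=` P d.
  apply: h => x _.
  have /cvgrPdist_lt/(_ 2^-1)[|_ [[W oW <-] Wx WU]] := cf x.
    by rewrite invr_gt0.
  have /nbhs_ballP[e /= e0 eW] : nbhs (set_val x) W.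
    by apply: open_nbhs_nbhs; split.
  have e20 : 0 < e / 2 by rewrite divr_gt0.
  have ballU (y : K) : (forall i, `|set_val x 0 i - set_val y 0 i| < e) ->
      `|f x - f y| < 2^-1.
    move=> xy; apply: WU; apply: eW; split=> // i j.
    by rewrite (ord1 i) -ball_normE /=; exact: xy.
  exists ([set x' : K | ball (set_val x) (e / 2) (set_val x')], [set d | d < e / 2]).
    split => /=; last exact: nbhs_right_lt.
    have : nbhs (set_val x) (ball (set_val x : 'rV[R]_k.+1) (e / 2)).
      exact: nbhsx_ballx.
    exact: initial_continuous.
  move=> [x' d] /= [[_ xx'] de] y yd.
  have {}xx' i : `|set_val x 0 i - set_val x' 0 i| < e / 2.
    by have := xx' 0 i; rewrite -ball_normE.
  have h1 : `|f x - f x'| < 2^-1.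
    by apply: ballU => i; apply: lt_trans (xx' i) _; lra.
  have h2 : `|f x - f y| < 2^-1.
    apply: ballU => i; rewrite -(subrKA (set_val x' 0 i)).
    apply: le_lt_trans (ler_normD _ _) _; have := xx' i; have := yd i; lra.
  rewrite -(subrKA (f x)); apply: le_lt_trans (ler_normD _ _) _.
  by rewrite distrC; lra.
move=> hd; have : \forall d \near 0^'+, 0 < d /\ [set: K] `<=` P d.
  by apply: filterI => //; exact: nbhs_right_gt.
move=> /filter_ex[d [d0 dP]]; exists d => // x y; exact: (dP x I).
Qed.

End Simplex.

(** * Coning in a vector space *)

Section ConeCoordinates.
Variables (R : realType) (k : nat).

(* The point where the ray from the apex [e_0] through [x] meets the opposite
   face; it is [0] (not in the simplex) when [x] is the apex. *)
Definition link_row (x : 'rV[R]_k.+2) : 'rV[R]_k.+1 :=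
  \row_i (x 0 (fintype.lift ord0 i) / (1 - x 0 ord0)).

(** The default [vertex] is taken at the apex, where the cone multiplies by [1 - x_0 = 0]. *)
Definition link (x : std_simplex R k.+1) : std_simplex R k :=
  if pselect (std_simplex R k (link_row (set_val x))) is left lx
  then SigSub (mem_set lx) else vertex R k.

Lemma link_row_simplex (x : std_simplex R k.+1) :
  set_val x 0 ord0 != 1 -> std_simplex R k (link_row (set_val x)).
Proof.
move=> x1; split=> [i|].
  by rewrite mxE divr_ge0 ?subr_ge0 ?simplex_ge0 ?simplex_le1.
under eq_bigr do rewrite mxE.
rewrite -mulr_suml; have := simplex_sum x; rewrite big_ord_recl => e.
rewrite (_ : \sum_i _ = 1 - set_val x 0 ord0); last by rewrite -e addrC addKr.
by rewrite divff // subr_eq0 eq_sym.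
Qed.

Lemma set_val_link (x : std_simplex R k.+1) :
  set_val x 0 ord0 != 1 -> set_val (link x) = link_row (set_val x).
Proof. by move=> /link_row_simplex lx; rewrite /link; case: pselect. Qed.

(** Away from the apex this is a product of continuous functions. At the apex [link] has no limit,
    but [g] is bounded by compactness and the other factor tends to [0]. *)
Lemma continuous_cone_real (g : std_simplex R k -> R) : continuous g ->
  continuous (fun x : std_simplex R k.+1 => (1 - set_val x 0 ord0) * g (link x)).
Proof.
move=> cg x; have FF := @nbhs_filter _ x.
have c0 : (fun y : std_simplex R k.+1 => 1 - set_val y 0 ord0) @ x -->
    1 - set_val x 0 ord0.
  by apply: cvgB; [exact: cvg_cst|exact: continuous_simplex_coord].
have [x1|x1] := eqVneq (set_val x 0 ord0) 1; last first.
  apply: cvgM => //; apply: (@cvg_comp _ _ _ link g); last exact: cg.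
  apply: cvg_simplex => i; rewrite set_val_link // mxE.
  have : (fun y : std_simplex R k.+1 =>
      set_val y 0 (fintype.lift ord0 i) / (1 - set_val y 0 ord0)) @ x -->
      set_val x 0 (fintype.lift ord0 i) / (1 - set_val x 0 ord0).
    apply: cvgM; first exact: continuous_simplex_coord.
    by apply: cvgV => //; rewrite subr_eq0 eq_sym.
  apply: cvg_trans; apply: near_eq_cvg.
  have nx : nbhs x [set y : std_simplex R k.+1 | 1 - set_val y 0 ord0 != 0].
    by apply: cvgr_neq0 c0 _; rewrite subr_eq0 eq_sym.
  apply: (@filterS _ (nbhs x) FF _ _ _ nx) => y /=; rewrite subr_eq0 eq_sym => y1.
  by rewrite set_val_link // mxE.
suff h0 : (fun y : std_simplex R k.+1 => (1 - set_val y 0 ord0) * g (link y))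
    @ x --> (0 : R) by rewrite /continuous_at x1 subrr mul0r.
have [M M0 gM] := simplex_bounded cg.
apply/cvgrPdist_lt => e e0.
have /cvgrPdist_lt/(_ (e / (M + 1))) := c0; rewrite x1 subrr.
move=> /(_ (divr_gt0 e0 (ltr_wpDl M0 ltr01))).
apply: filterS => y; rewrite !sub0r !normrN normrM => h.
rewrite (le_lt_trans (ler_wpM2l (normr_ge0 _) (gM _))) //.
rewrite ltr_pdivlMr ?ltr_wpDl // in h.
by apply: le_lt_trans h; rewrite ler_wpM2l // lerDl.
Qed.

Lemma link_coface0 (x : std_simplex R k) : link (coface ord0 x) = x.
Proof.
apply: val_inj; change (set_val (link (coface ord0 x)) = set_val x).
rewrite set_val_link /= ?coface_row_none ?(eq_sym 0) ?oner_eq0 //.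
apply/rowP => i; rewrite mxE coface_row_none subr0 divr1.
by rewrite coface_row_lift.
Qed.

Lemma coface_lift0 (i : 'I_k.+2) (x : 'rV[R]_k.+1) :
  i != ord0 -> coface_row i x 0 ord0 = x 0 ord0.
Proof.
move=> i0; have -> : ord0 = fintype.lift i ord0 :> 'I_k.+2.
  by apply: val_inj; move: i0; rewrite -val_eqE /= /bump; lia.
by rewrite coface_row_lift; congr (x _ _); apply: val_inj.
Qed.

End ConeCoordinates.

Lemma link_coface (R : realType) k (i : 'I_k.+2) (x : std_simplex R k.+1) :
  set_val x 0 ord0 != 1 ->
  link (coface (fintype.lift ord0 i) x) = coface i (link x).
Proof.
move=> x1; apply: val_inj.
change (set_val (link (coface (fintype.lift ord0 i) x)) =
  coface_row i (set_val (link x))).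
rewrite set_val_link /= ?coface_lift0 // set_val_link //.
apply/rowP => j; rewrite mxE coface_lift0 //.
have [j' ->|->] := unliftP i j.
  rewrite coface_row_lift [RHS]mxE.
  have -> : fintype.lift ord0 (fintype.lift i j') =
      fintype.lift (fintype.lift ord0 i) (fintype.lift ord0 j').
    by apply: val_inj; rewrite /= /bump; lia.
  by rewrite coface_row_lift.
by rewrite !coface_row_none mul0r.
Qed.

Section Cone.
Variables (R : realType) (n : nat).
Local Notation E := ('cV[Cplx R]_n : topologicalType).
Local Notation S := (singular_simplex R E).

Lemma Re_scale (a : R) (z : Cplx R) : complex.Re (a%:C%C * z) = a * complex.Re z.
Proof. by case: z => u v /=; rewrite mul0r subr0. Qed.

Lemma Im_scale (a : R) (z : Cplx R) : complex.Im (a%:C%C * z) = a * complex.Im z.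
Proof. by case: z => u v /=; rewrite mul0r addr0. Qed.

Definition cone_fun k (s : S k) (x : std_simplex R k.+1) : E :=
  ((1 - set_val x 0 ord0)%:C%C : Cplx R) *: s (link x).

Lemma continuous_cone_fun k (s : S k) : continuous (cone_fun s).
Proof.
have cs : continuous s by exact: cts_fun.
move=> x; apply/(cvg_cplx_mxP (cone_fun s) (cone_fun s x) (@nbhs_filter _ x)) => i j.
have h y : (s @ y --> s y) by exact: cs.
split.
  under eq_fun do rewrite mxE Re_scale.
  rewrite mxE Re_scale.
  apply: (@continuous_cone_real R k (fun y => complex.Re (s y i j))) => y.
  by have /(cvg_cplx_mxP _ _ (@nbhs_filter _ y))/(_ i j)[] := h y.
under eq_fun do rewrite mxE Im_scale.
rewrite mxE Im_scale.
apply: (@continuous_cone_real R k (fun y => complex.Im (s y i j))) => y.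
by have /(cvg_cplx_mxP _ _ (@nbhs_filter _ y))/(_ i j)[] := h y.
Qed.

HB.instance Definition _ k (s : S k) :=
  @isContinuous.Build _ _ (cone_fun s) (@continuous_cone_fun k s).

Definition cone k (s : S k) : S k.+1 := cone_fun s.

Definition origin k : S k := cst 0.

Lemma face0_cone k (s : S k) : face ord0 (cone s) = s.
Proof.
apply/continuousEP => x; rewrite /= /cone_fun /= link_coface0.
by rewrite coface_row_none subr0 scale1r.
Qed.

Lemma face_cone k (i : 'I_k.+2) (s : S k.+1) :
  face (fintype.lift ord0 i) (cone s) = cone (face i s).
Proof.
apply/continuousEP => x; rewrite /= /cone_fun /= coface_lift0 //.
have [->|x1] := eqVneq (set_val x 0 ord0) 1; first by rewrite subrr !scale0r.
by rewrite link_coface.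
Qed.

Lemma face1_cone (s : S 0) : face (fintype.lift ord0 ord0) (cone s) = origin 0.
Proof.
apply/continuousEP => x; rewrite /= /cone_fun /= coface_lift0 //.
have := simplex_sum x; rewrite big_ord1 => ->.
by rewrite subrr scale0r.
Qed.

Lemma cone_boundary k (c : chain R E k.+1) :
  ssboundary (@face R E) k.+1 (freeg_map (@cone k.+1) c) =
  c - freeg_map (@cone k) (ssboundary (@face R E) k c).
Proof.
pose d k := ssboundary (@face R E) k.
move: c; apply: (freeg_linear_ext (g := d k.+1 \o freeg_map (@cone k.+1))
  (h := idfun \- (freeg_map (@cone k) \o d k))) => s.
rewrite -[LHS]/(d k.+1 (freeg_map (@cone k.+1) << s >>)).
rewrite -[RHS]/(<< s >> - freeg_map (@cone k) (d k << s >>)).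
rewrite freeg_mapU /d !ssboundaryU big_ord_recl face0_cone.
rewrite expr0; congr (_ + _); rewrite linear_sum -sumrN; apply: eq_bigr => i _.
by rewrite freeg_mapU face_cone /= freegUN /bump exprS mulN1r.
Qed.

Definition augmentation : {linear chain R E 0 -> rat^o} :=
  linear_lift (fun=> 1 : rat^o).

(** The cone over a point is a path whose other end is the origin. This extra term is what leaves
    [H_0] one-dimensional. *)
Lemma cone_boundary0 (c : chain R E 0) :
  ssboundary (@face R E) 0 (freeg_map (@cone 0) c) =
  c - augmentation c *: << origin 0 >>.
Proof.
pose d := ssboundary (@face R E) 0.
have -> : augmentation c *: << origin 0 >> =
    freeg_map (fun=> origin 0) c :> chain R E 0.
  rewrite -(freeg_sumE c) !linear_sum scaler_suml; apply: eq_bigr => s _.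
  by rewrite freeg_mapU /= linear_liftU freegZU [_ *: _]mulr1 mulr1.
move: c; apply: (freeg_linear_ext (g := d \o freeg_map (@cone 0))
  (h := idfun \- freeg_map (fun=> origin 0))) => s.
rewrite -[LHS]/(d (freeg_map (@cone 0) << s >>)).
rewrite -[RHS]/(<< s >> - freeg_map (fun=> origin 0) << s >>).
rewrite !freeg_mapU /d ssboundaryU big_ord_recl big_ord1 face0_cone face1_cone.
by rewrite freegUN.
Qed.

Lemma augmentation_boundary (c : chain R E 1) :
  augmentation (ssboundary (@face R E) 0 c) = 0.
Proof.
rewrite -(freeg_sumE c) !linear_sum big1 // => s _.
rewrite /= linear_liftU big_ord_recl big_ord1 linearZ linearD /= !linear_liftU.
by rewrite !scale1r expr1 scaleN1r subrr scaler0.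
Qed.

Lemma vector_space_finite_homology :
  has_finite_homology (ssboundary (@face R E)).
Proof.
exists (fun k => (k == 0)%N : nat), 1%N; split=> [[|k]|[|k]] //=.
  exists (fun=> << origin 0 >>); split=> // c _.
  exists (const_mx (augmentation c)); split=> [|a [e]].
    by exists (freeg_map (@cone 0) c); rewrite big_ord1 mxE cone_boundary0.
  rewrite big_ord1 => /(congr1 augmentation).
  rewrite augmentation_boundary linearB linearZ /= linear_liftU => /eqP.
  rewrite scale1r subr_eq0 => /eqP ->; apply/rowP => i.
  by rewrite mxE (ord1 i) [_ *: _]mulr1.
exists (fun=> 0); split=> [i|c c0]; first by rewrite /= linear0.
exists 0; split=> [|a _]; last by apply/rowP => -[].
exists (freeg_map (@cone k.+1) c).
by rewrite cone_boundary c0 linear0 subr0 big_ord0 subr0.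
Qed.

End Cone.

(** * Lifting simplices to the universal cover *)

Section CircleLifting.
Variable R : realType.

Lemma cos_sin_period (x : R) (z : int) :
  cos (x + 2 * pi * z%:~R) = cos x /\ sin (x + 2 * pi * z%:~R) = sin x.
Proof.
have e (m : nat) : 2 * pi * m%:~R = pi *+ 2 *+ m :> R.
  by rewrite mulr_natl pmulrn mulr_natr.
case: z => m; first by rewrite e !(periodicn (@cosD2pi R), periodicn (@sinD2pi R)).
rewrite NegzE mulrNz mulrN.
set a := x - _; have -> : x = a + 2 * pi * m.+1%:~R by rewrite subrK.
by rewrite e !(periodicn (@cosD2pi R), periodicn (@sinD2pi R)).
Qed.

(** For the fractional part [r] of the quotient, [cos (2 pi r) = 1] forces [sin (pi r) = 0]; but the
    sine is positive on the open interval from [0] to [pi], so [r = 0]. *)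
Lemma cos_sin_eq (x y : R) :
  cos x = cos y -> sin x = sin y -> (x - y) / (2 * pi) \is a Num.int.
Proof.
move=> cxy sxy; have pi0 := @pi_gt0 R.
set t := _ / _; have te : x - y = 2 * pi * t.
  by rewrite /t mulrC divfK // mulf_neq0 ?gt_eqF.
pose r := t - (Num.floor t)%:~R.
have /andP[r0 r1] : 0 <= r < 1.
  have := floor_itv t; rewrite /r intrD1; lra.
have cr : cos ((pi * r) *+ 2) = 1.
  have -> : (pi * r) *+ 2 = x - y + 2 * pi * (- Num.floor t)%:~R.
    by rewrite te /r intrN -mulr_natl; ring.
  by rewrite (cos_sin_period _ _).1 cosB cxy sxy -!expr2 cos2Dsin2.
have [r00|rn0] := eqVneq r 0.
  by move/eqP: r00; rewrite subr_eq0 => /eqP ->; rewrite intr_int.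
have : 0 < sin (pi * r).
  apply: sin_gt0_pi; rewrite pmulr_rgt0 // lt_neqAle eq_sym rn0 r0 /=.
  by rewrite gtr_pMr.
move: cr; rewrite cos_mulr2n; have := cos2Dsin2 (pi * r); nra.
Qed.

Lemma circle_angle (c s : R) : c ^+ 2 + s ^+ 2 = 1 ->
  exists t, cos t = c /\ sin t = s.
Proof.
move=> cs; have c1 : -1 <= c <= 1 by nra.
have [s0|s0] := leP 0 s.
  exists (acos c); rewrite acosK ?in_itv //= sin_acos //.
  by rewrite -cs addrC addKr sqrtr_sqr ger0_norm.
exists (- acos c); rewrite cosN sinN acosK ?in_itv //= sin_acos //.
by rewrite -cs addrC addKr sqrtr_sqr ltr0_norm ?opprK.
Qed.

Variable k : nat.
Local Notation K := (std_simplex R k).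

(* Along the segments from a vertex [b], the angle is a sum of [N] small
   increments; by uniform continuity each lies in [(-pi/2, pi/2)], where the
   arcsine is a continuous inverse of the sine. *)
Lemma circle_lift (c s : K -> R) : continuous c -> continuous s ->
  (forall x, c x ^+ 2 + s x ^+ 2 = 1) ->
  exists2 t : K -> R, continuous t & forall x, cos (t x) = c x /\ sin (t x) = s x.
Proof.
move=> cc cs cs1.
have [dc dc0 dcP] := simplex_uniform cc.
have [ds ds0 dsP] := simplex_uniform cs.
pose d := Num.min dc ds.
have d0 : 0 < d by rewrite lt_min dc0.
pose N := (Num.bound d^-1).+1.
have Nd : N%:R^-1 < d.
  rewrite invf_plt ?posrE ?ltr0n //; apply: lt_le_trans (archi_boundP _) _.
    by rewrite invr_ge0 ltW.
  by rewrite ler_nat.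
pose b := vertex R k.
pose z i x := segment b x (i%:R / N%:R).
have cz i : continuous (z i) by move=> x; exact: continuous_segmentr.
have zN x : z N x = x by rewrite /z divff ?pnatr_eq0 // segment1.
have z0 x : z 0%N x = b by rewrite /z mul0r segment0.
have step i x j : (i < N)%N -> `|set_val (z i.+1 x) 0 j - set_val (z i x) 0 j| < d.
  move=> iN; rewrite /= /segment_row !mxE !clamp_id; last 2 first.
  - by rewrite divr_ge0 ?ler0n // ler_pdivrMr ?ltr0n // mul1r ler_nat ltnW.
  - by rewrite divr_ge0 ?ler0n // ler_pdivrMr ?ltr0n // mul1r ler_nat.
  set p := ((_ == _) && _)%:R; set q : R := set_val x 0 j.
  have p01 : 0 <= p <= 1.
    by rewrite /p; case: (j == ord0); rewrite ?andbT ?andbF ?eqxx /= ?lexx ?ler01.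
  have q01 : 0 <= q <= 1 by rewrite simplex_ge0 simplex_le1.
  rewrite (_ : _ - _ = N%:R^-1 * (q - p)); last first.
    by rewrite -natr1; ring.
  rewrite normrM gtr0_norm ?invr_gt0 ?ltr0n //; apply: le_lt_trans Nd.
  by rewrite ler_piMr ?invr_ge0 ?ler0n // ler_norml; lra.
suff main m : (m <= N)%N -> exists2 t : K -> R, continuous t &
    forall x, cos (t x) = c (z m x) /\ sin (t x) = s (z m x).
  have [t ct tP] := main N (leqnn N).
  by exists t => // x; have := tP x; rewrite zN.
elim: m => [_|m IH mN].
  have [t0 [ct0 st0]] := circle_angle (cs1 b).
  by exists (fun=> t0) => [x|x]; [exact: (@cst_continuous _ _ t0 x)|rewrite z0; split].
have [t ct tP] := IH (ltnW mN).
(* [v] and [u] are the sine and cosine of the angle from step [m] to step [m + 1]. The squared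
   distance of the two unit vectors is [2 - 2 u]; each coordinate moves by less than [1], so [u > 0]
   and [asin v] is the right angle. *)
pose v x := s (z m.+1 x) * c (z m x) - c (z m.+1 x) * s (z m x).
pose u x := c (z m.+1 x) * c (z m x) + s (z m.+1 x) * s (z m x).
have u0 x : 0 < u x.
  have h1 : `|c (z m.+1 x) - c (z m x)| < 1.
    by apply: dcP => i; apply: lt_le_trans (step _ _ _ mN) _; rewrite ge_min lexx.
  have h2 : `|s (z m.+1 x) - s (z m x)| < 1.
    by apply: dsP => i; apply: lt_le_trans (step _ _ _ mN) _; rewrite ge_min lexx orbT.
  move: h1 h2; rewrite !ltr_norml /u; have := cs1 (z m.+1 x); have := cs1 (z m x).
  move=> e1 e2 /andP[? ?] /andP[? ?]; nra.
have uv x : u x ^+ 2 + v x ^+ 2 = 1.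
  rewrite /u /v -[RHS]mulr1 -{1}(cs1 (z m.+1 x)) -(cs1 (z m x)); ring.
have cv : continuous v.
  move=> x; have FF := @nbhs_filter _ x; apply: cvgB; apply: cvgM;
    by apply: (@continuous_comp _ _ _ (z _)); [exact: cz|first [exact: cc|exact: cs]].
have v1 x : -1 < v x < 1 by have := uv x; have := u0 x; nra.
have v1' x : -1 <= v x <= 1 by have /andP[/ltW -> /ltW ->] := v1 x.
exists (fun x => t x + asin (v x)) => [x|x].
  have FF := @nbhs_filter _ x; apply: cvgD; first exact: ct.
  by apply: (@continuous_comp _ _ _ v); [exact: cv|exact: continuous_asin].
have [e1 e2] := tP x.
have ca : cos (asin (v x)) = u x.
  by rewrite cos_asin // -(uv x) addrK sqrtr_sqr gtr0_norm.
rewrite cosD sinD ca asinK ?in_itv //= e1 e2 /u /v; have := cs1 (z m x) => e.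
split.
  rewrite -[RHS]mulr1 -e; ring.
rewrite -[RHS]mulr1 -e; ring.
Qed.

End CircleLifting.

(** * Lattice coordinates on the torus, and lifts of simplices *)

Section LatticeBasis.
Variables (R : realType) (n : nat) (L : lattice n) (B : 'M[rat]_n).
Hypotheses (Bu : B \in unitmx).
Hypothesis LB : lattice_set L = [set B *m map_mx intr z | z in [set: 'cV[int]_n]].

Local Notation E := ('cV[Cplx R]_n : topologicalType).

Definition cplx_basis : 'M[Cplx R]_n := map_mx ratr B.

Definition lattice_coords (x : 'cV[Cplx R]_n) : 'cV[Cplx R]_n :=
  invmx cplx_basis *m x.

Lemma cplx_basis_unit : cplx_basis \in unitmx.
Proof. by rewrite /cplx_basis map_unitmx. Qed.

Lemma lattice_coordsK x : cplx_basis *m lattice_coords x = x.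
Proof. by rewrite mulmxA mulmxV ?mul1mx // cplx_basis_unit. Qed.

Lemma lattice_coordsB x y :
  lattice_coords (x - y) = lattice_coords x - lattice_coords y.
Proof. exact: mulmxBr. Qed.

Definition int_point (z : 'cV[int]_n) : 'cV[Cplx R]_n :=
  map_mx ratr (B *m map_mx intr z).

Lemma lattice_coords_int_point z : lattice_coords (int_point z) = map_mx intr z.
Proof.
rewrite /lattice_coords /int_point map_mxM mulmxA mulVmx ?cplx_basis_unit // mul1mx.
by apply/matrixP => i j; rewrite !mxE rmorph_int.
Qed.

Lemma int_point0 : int_point 0 = 0.
Proof. by rewrite /int_point map_mx0 mulmx0 map_mx0. Qed.

Lemma int_pointD z z' : int_point (z + z') = int_point z + int_point z'.
Proof. by rewrite /int_point map_mxD mulmxDr map_mxD. Qed.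

Lemma int_pointN z : int_point (- z) = - int_point z.
Proof. by rewrite /int_point map_mxN mulmxN map_mxN. Qed.

Lemma int_point_lattice z : lattice_set L (B *m map_mx intr z).
Proof. by rewrite LB; exists z. Qed.

Lemma lattice_mem (l : 'cV[rat]_n) :
  lattice_set L l -> exists z, map_mx ratr l = int_point z.
Proof. by rewrite LB => -[z _ <-]; exists z. Qed.

Lemma torus_pi_eq (x y : 'cV[Cplx R]_n) :
  torus_pi L x = torus_pi L y <-> exists z, y = x + int_point z.
Proof.
split=> [/eqmodP/asboolP[l /lattice_mem[z lz] xy]|[z ->]].
  by exists (- z); rewrite int_pointN -lz -xy subKr.
apply/eqmodP/asboolP; exists (B *m map_mx intr (- z)).
  exact: int_point_lattice.
rewrite -/(int_point (- z)) opprD addNKr.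
by rewrite int_pointN.
Qed.

Lemma intr_cplx (z : int) : (z%:~R : Cplx R) = (z%:~R : R)%:C%C.
Proof. by rewrite rmorph_int. Qed.

Lemma int_pointP (v : 'cV[Cplx R]_n) :
  (exists z, v = int_point z) <->
  forall i, complex.Re (lattice_coords v i 0) \is a Num.int /\
            complex.Im (lattice_coords v i 0) = 0.
Proof.
split=> [[z ->] i|h].
  by rewrite lattice_coords_int_point mxE intr_cplx /= intr_int.
pose z : 'cV[int]_n := \col_i Num.floor (complex.Re (lattice_coords v i 0)).
have zE i : z i 0 = Num.floor (complex.Re (lattice_coords v i 0)) by rewrite mxE.
exists z; rewrite -[LHS]lattice_coordsK -[RHS]lattice_coordsK lattice_coords_int_point.
congr (_ *m _); apply/colP => i; rewrite [RHS]mxE zE intr_cplx.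
have [/floorK -> im] := h i.
by move: im; case: (lattice_coords v i 0) => a b /= ->.
Qed.

Lemma continuous_cplx_mulmx (T : topologicalType) (A : 'M[Cplx R]_n)
    (f : T -> 'cV[Cplx R]_n) :
  continuous f -> continuous (fun x => A *m f x).
Proof.
move=> cf x; have FF := @nbhs_filter _ x.
apply: cvg_mx_entries => i j; under eq_fun do rewrite mxE.
rewrite mxE; apply: cvg_big => [|l _]; first exact: add_continuous.
apply: cvgMr.
exact: (cvg_comp _ _ (cf x) (@coord_continuous (Cplx R) _ _ l j (f x))).
Qed.

Lemma continuous_Re_coord (T : topologicalType) (f : T -> 'cV[Cplx R]_n) i :
  continuous f -> continuous (fun x => complex.Re (f x i 0)).
Proof.
move=> cf x.
by have /(cvg_cplx_mxP _ _ (@nbhs_filter _ x))/(_ i 0)[] := cf x.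
Qed.

Lemma continuous_Im_coord (T : topologicalType) (f : T -> 'cV[Cplx R]_n) i :
  continuous f -> continuous (fun x => complex.Im (f x i 0)).
Proof.
move=> cf x.
by have /(cvg_cplx_mxP _ _ (@nbhs_filter _ x))/(_ i 0)[] := cf x.
Qed.

Lemma continuous_torus_pi : continuous (@torus_pi R n L).
Proof. exact: pi_continuous. Qed.

(** [repr] is in general discontinuous, but a continuous function invariant under the lattice does
    not see the choice of representative. *)
Lemma continuous_torus_function (g : 'cV[Cplx R]_n -> R) :
  continuous g -> (forall x z, g (x + int_point z) = g x) ->
  continuous (fun t : torus R L => g (generic_quotient.repr t)).
Proof.
move=> cg gz; apply: (repr_comp_continuous cg) => x y /eqP/torus_pi_eq[z ->].
by rewrite gz.
Qed.

Lemma torus_piK (t : torus R L) : torus_pi L (generic_quotient.repr t) = t.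
Proof. exact: generic_quotient.reprK. Qed.

(** The lattice is real, so the imaginary coordinates descend to the torus and are kept. Each real
    coordinate [a] is defined modulo [1] only: [circle_lift] is applied to the cosine and sine of
    [2 pi a], and the angle is divided by [2 pi]. *)
Lemma torus_lift k (tau : std_simplex R k -> torus R L) : continuous tau ->
  exists2 sigma : std_simplex R k -> 'cV[Cplx R]_n,
    continuous sigma & forall x, torus_pi L (sigma x) = tau x.
Proof.
move=> ctau; pose w x := lattice_coords (generic_quotient.repr (tau x)).
have cid' : continuous (fun x : 'cV[Cplx R]_n => x) by move=> x; exact: cvg_id.
have cRe i : continuous (fun x => complex.Re (lattice_coords x i 0)).
  by apply: continuous_Re_coord; exact: continuous_cplx_mulmx.
have cIm i : continuous (fun x => complex.Im (lattice_coords x i 0)).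
  by apply: continuous_Im_coord; exact: continuous_cplx_mulmx.
have ReD i x z : complex.Re (lattice_coords (x + int_point z) i 0) =
    complex.Re (lattice_coords x i 0) + (z i 0)%:~R.
  rewrite /lattice_coords mulmxDr -!/(lattice_coords _) lattice_coords_int_point.
  by rewrite !mxE intr_cplx; case: (\sum_j _).
have ImD i x z : complex.Im (lattice_coords (x + int_point z) i 0) =
    complex.Im (lattice_coords x i 0).
  rewrite /lattice_coords mulmxDr -!/(lattice_coords _) lattice_coords_int_point.
  by rewrite !mxE intr_cplx; case: (\sum_j _) => a b /=; rewrite addr0.
have cpt (g : 'cV[Cplx R]_n -> R) : continuous g ->
    (forall x z, g (x + int_point z) = g x) ->
    continuous (fun x => g (generic_quotient.repr (tau x))).
  move=> cg gz x; apply: (@continuous_comp _ _ _ tau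
    (fun t : torus R L => g (generic_quotient.repr t))); first exact: ctau.
  exact: continuous_torus_function.
have /choice[t tP] i : exists t : std_simplex R k -> R, continuous t /\
    forall x, cos (t x) = cos (2 * pi * complex.Re (w x i 0)) /\
              sin (t x) = sin (2 * pi * complex.Re (w x i 0)).
  have [||x|t ct tP] := @circle_lift R k
    (fun x => cos (2 * pi * complex.Re (w x i 0)))
    (fun x => sin (2 * pi * complex.Re (w x i 0))).
  - apply: (cpt (fun y => cos (2 * pi * complex.Re (lattice_coords y i 0)))).
      move=> x; apply: (@continuous_comp _ _ _
        (fun y => 2 * pi * complex.Re (lattice_coords y i 0)) cos); last first.
        exact: continuous_cos.
      by have FF := @nbhs_filter _ x; apply: cvgMr; exact: cRe.
    by move=> x z; rewrite ReD mulrDr (cos_sin_period _ _).1.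
  - apply: (cpt (fun y => sin (2 * pi * complex.Re (lattice_coords y i 0)))).
      move=> x; apply: (@continuous_comp _ _ _
        (fun y => 2 * pi * complex.Re (lattice_coords y i 0)) sin); last first.
        exact: continuous_sin.
      by have FF := @nbhs_filter _ x; apply: cvgMr; exact: cRe.
    by move=> x z; rewrite ReD mulrDr (cos_sin_period _ _).2.
  - exact: cos2Dsin2.
  - by exists t.
pose u x : 'cV[Cplx R]_n :=
  \col_i ((t i x / (2 * pi)) +i* complex.Im (w x i 0))%C.
exists (fun x => cplx_basis *m u x).
  apply: continuous_cplx_mulmx => x.
  have FF := @nbhs_filter _ x.
  apply/(cvg_cplx_mxP u (u x) FF) => i j; split.
    under eq_fun do rewrite mxE /=.
    rewrite mxE /=; apply: cvgMl; exact: (tP i).1.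
  under eq_fun do rewrite mxE /=.
  rewrite mxE /=.
  exact: (cpt (fun y => complex.Im (lattice_coords y i 0)) (cIm i) (ImD i)).
move=> x; rewrite -[RHS]torus_piK; apply/esym/torus_pi_eq.
pose v := cplx_basis *m u x - generic_quotient.repr (tau x).
suff /int_pointP[z e] : forall i,
    complex.Re (lattice_coords v i 0) \is a Num.int /\
    complex.Im (lattice_coords v i 0) = 0.
  by exists z; rewrite -e addrC subrK.
move=> i; rewrite /v lattice_coordsB {1 3}/lattice_coords mulmxA mulVmx ?cplx_basis_unit //.
rewrite mul1mx -/(w x); have [_ /(_ x)] := tP i.
rewrite /u; move: (w x) => W; rewrite !mxE.
case: (W i 0) => a b /= [ec es]; split; last by rewrite subrr.
have := cos_sin_eq ec es.
by rewrite mulrBl [2 * pi * a]mulrC mulfK // mulf_neq0 // gt_eqF ?pi_gt0.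
Qed.

End LatticeBasis.

(** * Euler characteristics of the torus and of fixed loci *)

Definition simplex_of (R : realType) (X : topologicalType) k
    (f : std_simplex R k -> X) (cf : continuous f) : singular_simplex R X k :=
  mkcts cf.

Section TorusEulerCharacteristic.
Variables (R : realType) (n : nat) (L : lattice n) (B : 'M[rat]_n).
Hypotheses (Bu : B \in unitmx).
Hypothesis LB : lattice_set L = [set B *m map_mx intr z | z in [set: 'cV[int]_n]].
Local Notation E := ('cV[Cplx R]_n : topologicalType).
Local Notation ip := (@int_point R n B).

Lemma int_point_constant k (f : std_simplex R k -> 'cV[Cplx R]_n) :
  continuous f -> (forall t, exists z, f t = ip z) ->
  exists z, forall t, f t = ip z.
Proof.
move=> cf fz; have [z ez] := fz (vertex R k); exists z => t; rewrite -ez.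
have cg : continuous (fun t => lattice_coords B (f t)).
  exact: continuous_cplx_mulmx.
rewrite -[LHS](lattice_coordsK Bu) -[RHS](lattice_coordsK Bu); congr (_ *m _).
apply/colP => i.
have re : complex.Re (lattice_coords B (f t) i 0) =
    complex.Re (lattice_coords B (f (vertex R k)) i 0).
  apply: (@continuous_int_constant R k
    (fun t => complex.Re (lattice_coords B (f t) i 0))).
    exact: continuous_Re_coord.
  by move=> x; have /(int_pointP Bu)/(_ i)[] := fz x.
have /(int_pointP Bu)/(_ i)[_] := fz t.
have /(int_pointP Bu)/(_ i)[_] := fz (vertex R k).
move: re; case: (lattice_coords B (f t) i 0) => a b.
by case: (lattice_coords _ _ _ _) => a' b' /= -> -> ->.
Qed.

Lemma int_point_inj : injective ip.
Proof.
move=> z z' /(congr1 (lattice_coords B)); rewrite !lattice_coords_int_point //.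
by move=> /matrixP h; apply/matrixP => i j; have := h i j; rewrite !mxE => /intr_inj.
Qed.

Lemma continuous_translate (T : topologicalType) (f : T -> 'cV[Cplx R]_n) v :
  continuous f -> continuous (fun x => f x + v).
Proof.
move=> cf x; have FF := @nbhs_filter _ x.
apply: cvg_mx_entries => i j; under eq_fun do rewrite mxE.
rewrite mxE; apply: cvgD; last exact: cvg_cst.
exact: (cvg_comp _ _ (cf x) (@coord_continuous (Cplx R) _ _ i j (f x))).
Qed.

Definition translate k (z : 'cV[int]_n) (s : singular_simplex R E k) :
    singular_simplex R E k :=
  simplex_of (@continuous_translate _ s (ip z) (@cts_fun _ _ s)).

Lemma translateE k z (s : singular_simplex R E k) x :
  translate z s x = s x + ip z.
Proof. by []. Qed.

(** The set [A] is kept as a variable because the fixed locus of the identity is a subspace equal to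
    the whole torus, not the torus as a type. *)
Lemma torus_euler_char (A : set (torus R L)) : (0 < n)%N -> A = setT ->
  is_euler_char R A 0.
Proof.
move=> n0 AT; apply: is_euler_charE.
have memA t : t \in A by rewrite AT inE.
pose incl (t : torus R L) : A := SigSub (memA t).
have cincl : continuous incl.
  by move=> t; apply: (cvg_set_val (@nbhs_filter _ t)); exact: cvg_id.
have cproj k (s : singular_simplex R E k) :
    continuous (fun x => incl (torus_pi L (s x))).
  move=> x; apply: (@continuous_comp _ _ _ (fun x => torus_pi L (s x)) incl); last first.
    exact: cincl.
  apply: (@continuous_comp _ _ _ s (@torus_pi R n L)); first exact: cts_fun.
  exact: continuous_torus_pi.
pose p k (s : singular_simplex R E k) : singular_simplex R A k := simplex_of (cproj k s).
apply: (@free_quotient_euler_char _ (@face R E) n (@translate) _ _ _ _ _ _ _ _ p n0).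
- exact: face_simplicial_identity.
- exact: vector_space_finite_homology.
- by move=> k s; apply/continuousEP => x; rewrite translateE int_point0 addr0.
- move=> k z z' s; apply/continuousEP => x; rewrite !translateE.
  by rewrite int_pointD addrAC addrA.
- move=> k z s /continuousEP/(_ (vertex R k)) /eqP.
  rewrite translateE -subr_eq0 addrAC subrr add0r -(int_point0 R B).
  by move=> /eqP/int_point_inj.
- by move=> k i z s; apply/continuousEP.
- by move=> k i s; apply/continuousEP.
- move=> k y.
  have cy : continuous (fun x => set_val (y x) : torus R L).
    move=> x; apply: (@continuous_comp _ _ _ y set_val); first exact: cts_fun.
    exact: initial_continuous.
  have [sigma csigma sP] := torus_lift Bu LB cy.
  exists (simplex_of csigma); apply/continuousEP => x; apply: val_inj.
  exact: sP.
- move=> k s s'; split=> [/continuousEP e|[z ->]].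
    have [|t|z zP] := @int_point_constant k (fun t => s' t - s t).
    + move=> x; have FF := @nbhs_filter _ x.
      apply: cvg_mx_entries => i j; under eq_fun do rewrite !mxE.
      rewrite !mxE; apply: cvgB.
        exact: (cvg_comp _ _ (@cts_fun _ _ s' x) (@coord_continuous (Cplx R) _ _ i j _)).
      exact: (cvg_comp _ _ (@cts_fun _ _ s x) (@coord_continuous (Cplx R) _ _ i j _)).
    + have /(congr1 val)/(torus_pi_eq LB)[z ->] := e t.
      by exists z; rewrite addrAC subrr add0r.
    exists z; by apply/continuousEP => x; rewrite translateE -(zP x) addrC subrK.
  apply/continuousEP => x; apply: val_inj; apply/(torus_pi_eq LB).
  by exists z.
Qed.

End TorusEulerCharacteristic.

(** * Spaces in which every singular simplex is constant *)

Section TotallyDisconnected.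
Variables (R : realType) (X : topologicalType).
Local Notation S := (singular_simplex R X).
Hypothesis simplex_const : forall k (s : S k) x y, s x = s y.

Definition point_simplex k (x : X) : S k := cst x.

Lemma point_simplexE k (s : S k) : s = point_simplex k (s (vertex R k)).
Proof. by apply/continuousEP => x; exact: simplex_const. Qed.

Definition change_dim k l (s : S k) : S l := point_simplex l (s (vertex R k)).

Lemma change_dimK k l : cancel (@change_dim k l) (@change_dim l k).
Proof. by move=> s; rewrite [RHS]point_simplexE. Qed.

(** All faces of a constant simplex agree. Identifying the simplices of every dimension with points,
    the boundary is the scalar [1 - 1 + 1 - ...], alternately [0] and [1]. *)
Lemma boundary_const k (c : chain R X k.+1) :
  ssboundary (@face R X) k c =
  (\sum_(i < k.+2) (-1) ^+ i) *: freeg_map (@change_dim k.+1 k) c.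
Proof.
set a := \sum_i _; rewrite -linearZ /=; move: c.
pose h := freeg_map (@change_dim k.+1 k) \o *:%R a.
apply: (freeg_linear_ext (h := h)) => s.
rewrite ssboundaryU -[RHS]/(freeg_map (@change_dim k.+1 k) (a *: << s >>)).
rewrite linearZ /= freeg_mapU scaler_suml; apply: eq_bigr => i _.
rewrite freegZU mulr1; congr (<< _ *g _ >>); rewrite [LHS]point_simplexE.
by congr point_simplex; exact: (simplex_const s (coface i (vertex R k))).
Qed.

Lemma sum_signs k : \sum_(i < k) (-1) ^+ i = (odd k)%:R :> rat.
Proof.
elim: k => [|k IH]; first by rewrite big_ord0.
rewrite big_ord_recr /= IH -signr_odd.
by case: odd; rewrite /= ?expr1 ?expr0 ?subrr ?add0r.
Qed.

Lemma finite_euler_char N (e : 'I_N -> X) : bijective e ->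
  is_euler_char R X N%:Z.
Proof.
move=> [e' eK e'K]; apply: is_euler_charE.
exists (fun k => if k is 0%N then N else 0%N), 1%N; split; last first.
- by rewrite big_ord1 mul1r.
- by case.
move=> [|k].
  have bd0 (d : sschain S 1) : ssboundary (@face R X) 0 d = 0.
    by rewrite boundary_const sum_signs /= scale0r.
  exists (fun i => << point_simplex 0 (e i) >>); split=> // c _.
  have cE (a : 'rV[rat]_N) j :
      coeff (point_simplex 0 (e j))
        (\sum_i a 0 i *: << point_simplex 0 (e i) >> : sschain S 0) = a 0 j.
    rewrite raddf_sum (bigD1 j) //= big1 ?addr0 => [|i ij].
      by rewrite coeffZ coeffU eqxx !mulr1.
    rewrite coeffZ coeffU; case: eqP => [|_]; last by rewrite !mulr0.
    move=> /continuousEP/(_ (vertex R 0)) /= /(can_inj eK) ji.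
    by rewrite ji eqxx in ij.
  exists (\row_i coeff (point_simplex 0 (e i)) c); split.
    exists 0; rewrite linear0; apply/eqP; rewrite subr_eq0; apply/eqP/eqP.
    apply/freeg_eqP => s; rewrite [s]point_simplexE -[s _]e'K cE mxE //.
  move=> a [d]; rewrite bd0 => /eqP; rewrite subr_eq0 => /eqP ->.
  by apply/rowP => j; rewrite mxE cE.
exists (fun=> 0); split=> [i|c c0]; first by rewrite /= linear0.
exists 0; split=> [|a _]; last by apply/rowP => -[].
have fK k' l (b : sschain S k') :
    freeg_map (@change_dim l k') (freeg_map (@change_dim k' l) b) = b.
  move: b; apply: (freeg_linear_ext (h := idfun)
    (g := freeg_map (@change_dim l k') \o freeg_map (@change_dim k' l))) => s.
  rewrite -[LHS]/(freeg_map (@change_dim l k') (freeg_map (@change_dim k' l) << s >>)).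
  by rewrite !freeg_mapU change_dimK.
(* In degree [k + 1], if [k] is odd, the outgoing boundary is an isomorphism and the cycle is [0];
   if [k] is even, the incoming one is an isomorphism and every chain is a boundary. *)
rewrite big_ord0 subr0; have [ok|ek] := boolP (odd k).
  exists 0; rewrite linear0; move: c0.
  rewrite /= boundary_const sum_signs /= negbK ok scale1r.
  by move=> /(congr1 (freeg_map (@change_dim k k.+1))); rewrite fK linear0.
exists (freeg_map (@change_dim _ _) c).
by rewrite boundary_const sum_signs /= negbK ek scale1r fK.
Qed.

End TotallyDisconnected.

(** * Representatives of [Z^n] modulo an integer matrix *)

Lemma int_diag_det n (d : seq int) :
  \det (\matrix_(i < n, j < n) (d`_i *+ (i == j :> nat))) = \prod_(i < n) d`_i.
Proof.
rewrite (_ : (\matrix_(i, j) _) = diag_mx (\row_i d`_i)).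
  by rewrite det_diag; apply: eq_bigr => i _; rewrite mxE.
by apply/matrixP => i j; rewrite !mxE.
Qed.

(* Read off the Smith normal form of [D]. *)
Lemma int_cokernel_transversal n (D : 'M[int]_n) : \det D != 0 ->
  exists e : 'I_`|\det D|%N -> 'cV[int]_n,
    (forall i j, (exists w, e i - e j = D *m w) -> i = j) /\
    (forall z, exists i, exists w, z - e i = D *m w).
Proof.
have [L Lu [U Uu [d _ DE]]] := int_Smith_normal_form D => D0.
have detD : \det D = \det L * (\prod_(i < n) d`_i) * \det U.
  by rewrite DE !det_mulmx int_diag_det.
have unit_abs (M : 'M[int]_n) : M \in unitmx -> `|\det M|%N = 1%N.
  move=> /mulmxV/(congr1 determinant)/(congr1 absz)/eqP.
  by rewrite det_mulmx det1 abszM muln_eq1 => /andP[/eqP].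
have absD : `|\det D|%N = (\prod_(i < n) `|(d`_i)%R|)%N.
  rewrite detD !abszM !unit_abs // mul1n muln1.
  exact: (big_morph absz abszM (erefl _)).
have d0 i : (i < n)%N -> d`_i != 0.
  move=> ilt; apply: contraNneq D0 => di0.
  by rewrite detD (bigD1 (Ordinal ilt)) //= di0 mul0r mulr0 mul0r.
(* Vectors of residues modulo the [d_i] represent the cokernel of the diagonal factor.
   Multiplication by [L] carries them to the cokernel of [D], since [U] is invertible over the
   integers. *)
pose F := {dffun forall i : 'I_n, 'I_`|(d`_i)%R|}.
have cardF : #|{: F}| = `|\det D|%N.
  rewrite absD card_dep_ffun foldrE big_map -big_enum /=.
  by apply: eq_bigr => i _; rewrite card_ord.
rewrite -cardF.
pose v (f : F) : 'cV[int]_n := \col_i (f i : nat)%:Z.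
exists (fun k => L *m v (enum_val k)); split => [k l [w e]|z].
  apply: enum_val_inj; move: (enum_val k) (enum_val l) e => f g e.
  have {}e : v f - v g = \matrix_(i, j) (d`_i *+ (i == j :> nat)) *m (U *m w).
    have := congr1 (mulmx (invmx L)) e.
    by rewrite DE -mulmxBr !mulmxA mulVmx // !mul1mx.
  apply/ffunP => i; apply: val_inj => /=.
  have := congr1 (fun M : 'cV[int]_n => M i 0) e; rewrite !mxE.
  rewrite (bigD1 i) //= big1 ?addr0 => [|j ji]; last first.
    by rewrite mxE [_ == _ :> nat]eq_sym val_eqE (negPf ji) mulr0n mul0r.
  rewrite mxE eqxx mulr1n => ei.
  have : ((f i : nat)%:Z == (g i : nat)%:Z %[mod d`_i])%Z.
    by rewrite eqz_mod_dvd ei dvdz_mulr.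
  have small (k' : 'I_`|(d`_i)%R|) : ((k' : nat)%:Z %% d`_i)%Z = k'.
    by rewrite -modz_abs modz_small //= ltz_nat ltn_ord.
  by rewrite !small => /eqP[].
pose u := invmx L *m z; have zu : invmx L *m z = u by [].
clearbody u.
have rlt i : (`|(u i ord0 %% d`_i)%Z| < `|(d`_i)%R|)%N.
  have := ltz_mod (u i ord0) (d0 i (ltn_ord i)).
  by rewrite -ltz_nat gez0_abs // modz_ge0 // d0.
pose f : F := [ffun i => Ordinal (rlt i)].
exists (enum_rank f), (invmx U *m \col_i (u i ord0 %/ d`_i)%Z).
rewrite enum_rankK DE -!mulmxA (mulmxA U) mulmxV // mul1mx.
apply: (can_inj (mulKVmx Lu)); rewrite mulmxBr !(mulmxA (invmx L)) mulVmx // !mul1mx zu.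
apply/colP => i; rewrite mxE [in RHS]mxE (bigD1 i) //= big1 ?addr0 => [|j ji]; last first.
  by rewrite mxE [_ == _ :> nat]eq_sym val_eqE (negPf ji) mulr0n mul0r.
rewrite !mxE eqxx mulr1n ffunE /= gez0_abs ?modz_ge0 ?d0 //.
by rewrite {1}(divz_eq (u i ord0) d`_i) addrK mulrC.
Qed.

Lemma inj_surj_bijective (T U : Type) (f : T -> U) :
  injective f -> (forall y, exists x, f x = y) -> bijective f.
Proof.
move=> f_inj /choice[g fK]; exists g => // x; exact/f_inj/fK.
Qed.

(** * The fixed locus of an element without eigenvalue [1] *)

Section FixedPoints.
Variables (R : realType) (gT : finGroupType) (G : {group gT}) (n : nat).
Variables (rG : mx_representation rat G n) (L : lattice n) (g : gT).
Hypotheses (invL : lattice_invariant rG L) (gG : g \in G).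
Hypothesis detg : \det (rG g - 1%:M) != 0.

(** With [M = rG g - 1], the fixed points are the classes of [M^-1 L] modulo [L]. Multiplication by
    [M] identifies them with [L / M L], which in lattice coordinates is [Z^n / D Z^n] for the
    integer matrix [D] conjugate to [rG g - 1]. *)
Lemma fixed_points_euler_char : exists N : nat,
  N%:R = `|\det (rG g - 1%:M)| /\
  is_euler_char R (Fix (torus_act R L rG g)) N%:Z.
Proof.
have [B Bu LB] := lattice_basis L.
pose ip := @int_point R n B.
have [A gB] : exists A : 'M[int]_n, rG g *m B = B *m map_mx intr A.
  have /choice[a aP] j : exists z : 'cV[int]_n,
      rG g *m (B *m map_mx intr (delta_mx j 0)) = B *m map_mx intr z.
    have := invL gG (int_point_lattice LB (delta_mx j 0)).
    by rewrite LB => -[z _ <-]; exists z.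
  exists (\matrix_(i, j) a j i 0); apply/trmx_inj/row_matrixP => j.
  rewrite -!tr_col; congr (_^T)%R; rewrite !colE -!mulmxA; have := aP j.
  rewrite map_delta_mx => ->; congr (_ *m _).
  rewrite -colE; apply/colP => i; rewrite !mxE //.
pose D := A - 1%:M.
have MB : (rG g - 1%:M) *m B = B *m map_mx intr D.
  by rewrite mulmxBl mul1mx gB /D map_mxB map_mx1 mulmxBr mulmx1.
have detD : (\det D)%:~R = \det (rG g - 1%:M) :> rat.
  have := congr1 determinant MB; rewrite !det_mulmx mulrC => /mulfI.
  rewrite -unitfE -unitmxE => /(_ Bu) ->; by rewrite det_map_mx.
have D0 : \det D != 0 by rewrite -(intr_eq0 rat) detD.
pose M : 'M[Cplx R]_n := map_mx ratr (rG g - 1%:M).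
have Mu : M \in unitmx by rewrite map_unitmx unitmxE unitfE.
have M_ip w : M *m ip w = ip (D *m w).
  by rewrite /ip /int_point -map_mxM mulmxA MB -mulmxA -map_mxM.
have fixP x : Fix (torus_act R L rG g) (torus_pi L x) <-> exists z, M *m x = ip z.
  have Mx : M *m x = complex_act rG g x - x.
    by rewrite /M map_mxB map_mx1 mulmxBl mul1mx.
  rewrite /Fix /= torus_actE // Mx; split => [/(torus_pi_eq LB)[z]|[z e]].
    move=> e; exists (- z); rewrite {2}e opprD addNKr.
    by rewrite /ip int_pointN.
  by apply/esym/(torus_pi_eq LB); exists z; rewrite -/(ip z) -e addrC subrK.
have [e [e_inj e_sur]] := int_cokernel_transversal D0.
exists `|\det D|%N; split; first by rewrite natr_absz intr_norm detD.
pose pt z : torus R L := torus_pi L (invmx M *m ip z).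
have ptP z : pt z \in Fix (torus_act R L rG g).
  by rewrite inE; apply/fixP; exists z; rewrite mulmxA mulmxV // mul1mx.
pose f i : Fix (torus_act R L rG g) := SigSub (ptP (e i)).
apply: (@finite_euler_char _ _ _ _ f).
  move=> k s x y; have cy : continuous (fun t => set_val (s t) : torus R L).
    move=> t; apply: (@continuous_comp _ _ _ s set_val); first exact: cts_fun.
    exact: initial_continuous.
  have [sigma csigma sP] := torus_lift Bu LB cy.
  have [|t|z zP] := @int_point_constant R n B Bu k (fun t => M *m sigma t).
  - exact: continuous_cplx_mulmx.
  - by apply/fixP; rewrite sP; exact: set_mem (valP (s t)).
  apply: val_inj; change (set_val (s x) = set_val (s y)).
  by rewrite -!sP -[sigma x](mulKmx Mu) -[sigma y](mulKmx Mu) !zP.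
apply: inj_surj_bijective => [i j /(congr1 val)/(torus_pi_eq LB)[w]|y].
  move=> /(congr1 (mulmx M)); rewrite mulmxDr !mulmxA mulmxV // !mul1mx M_ip -int_pointD => eij.
  apply/esym/e_inj; exists w; move: eij => /(int_point_inj Bu) ->.
  by rewrite addrAC subrr add0r.
have [z zP] : exists z, M *m generic_quotient.repr (set_val y) = ip z.
  by apply/fixP; rewrite torus_piK; exact: set_mem (valP y).
have [i [w ziw]] := e_sur z; exists i; apply: val_inj.
change (pt (e i) = set_val y); rewrite -[RHS]torus_piK.
apply/(torus_pi_eq LB); exists w.
apply: (can_inj (mulKmx Mu)); rewrite mulmxDr zP mulmxA mulmxV // mul1mx.
by rewrite M_ip -int_pointD -ziw addrC subrK.
Qed.

End FixedPoints.

(** * Determinants and cyclotomic polynomials *)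

(** Every root of [q] has the cyclotomic polynomial as its minimal polynomial over the rationals, so
    this factor can be split off until [q] is [1]. *)
Lemma cyclotomic_power (d : nat) (q : {poly rat}) : q \is monic ->
  (forall a : algC, root (map_poly ratr q) a -> d.-primitive_root a) ->
  exists e, q = map_poly intr (Cyclotomic d) ^+ e.
Proof.
have [N] := ubnP (size q); elim: N q => // N IH q sq mq rq.
have [sq1|sq1] := leqP (size q) 1.
  exists 0%N; rewrite expr0.
  have := mq; rewrite (size1_polyC sq1) monicE lead_coefC => /eqP ->.
  by [].
have [a ra] : exists a : algC, root (map_poly ratr q) a.
  by apply: (@closed_rootP algC _ _); rewrite size_map_poly; case: (size q) sq1 => [|[]].
have pa := rq a ra; have [p [pE mp] pP] := minCpolyP a.
have pd : p = map_poly intr (Cyclotomic d).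
  apply: (map_inj_poly (fmorph_inj (@ratr algC)) (rmorph0 _)).
  rewrite -pE (minCpoly_cyclotomic pa) -(Cintr_Cyclotomic pa) -map_poly_comp.
  by apply: eq_map_poly => z /=; rewrite rmorph_int.
have /dvdpP[q1 qE] : p %| q by rewrite -pP.
have mq1 : q1 \is monic by rewrite -(monicMr q1 mp) -qE.
have [||e eE] := IH q1 _ mq1.
- have : (size q = (size q1 + size p).-1)%N.
    by rewrite qE size_mul ?monic_neq0.
  have : (1 < size p)%N by rewrite -(size_map_poly (@ratr algC)) -pE size_minCpoly.
  have : (0 < size q1)%N by rewrite size_poly_gt0 monic_neq0.
  by move: (size q1) (size p) (size q) sq => x y z; lia.
- by move=> b rb; apply: rq; rewrite qE rmorphM rootM rb.
- by exists e.+1; rewrite qE eE exprSr pd.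
Qed.

(** * Eigenvalues and determinants in a fixed-point-free representation *)

Section FixedPointFree.
Variables (gT : finGroupType) (G : {group gT}) (n : nat).
Variables (rG : mx_representation rat G n) (g : gT).
Hypotheses (fpf : is_FPF rG) (gG : g \in G).

Lemma fpf_eigenvalue (a : algC) :
  root (map_poly ratr (char_poly (rG g))) a -> #[g]%g.-primitive_root a.
Proof.
rewrite map_char_poly -eigenvalue_root_char => /eigenvalueP[v va v0].
have vX j : v *m map_mx ratr (rG (g ^+ j)%g) = a ^+ j *: v.
  elim: j => [|j IH]; first by rewrite expg0 repr_mx1 map_mx1 mulmx1 scale1r.
  rewrite expgSr repr_mxM ?groupX // map_mxM mulmxA IH -scalemxAl va scalerA.
  by rewrite -exprSr.
have a1 : a ^+ #[g]%g = 1.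
  apply/eqP; rewrite -subr_eq0; have := vX #[g]%g.
  rewrite expg_order repr_mx1 map_mx1 mulmx1 => /eqP.
  rewrite -subr_eq0 -{1}[v]scale1r -scalerBl scaler_eq0 (negPf v0) orbF.
  by rewrite -oppr_eq0 opprB.
have [m pm md] := prim_order_exists (order_gt0 g) a1.
suff -> : #[g]%g = m by [].
apply/eqP; rewrite eqn_dvd md andbT order_dvdn; apply: contraT => gm.
have [_ /(_ _ (groupX m gG) gm) det0] := fpf.
have Mu : map_mx ratr (rG (g ^+ m)%g - 1%:M) \in @unitmx algC n.
  by rewrite map_unitmx unitmxE unitfE.
have : v *m map_mx ratr (rG (g ^+ m)%g - 1%:M) = 0.
  by rewrite map_mxB map_mx1 mulmxBr vX (prim_expr_order pm) scale1r mulmx1 subrr.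
move=> /(congr1 (mulmx^~ (invmx (map_mx ratr (rG (g ^+ m)%g - 1%:M))))).
by rewrite mulmxK // mul0mx => /eqP; rewrite (negPf v0).
Qed.

Lemma fpf_det : `|\det (rG g - 1%:M)| =
  `|(Cyclotomic #[g]%g).[1]|%:~R ^+ (n %/ totient #[g]%g).
Proof.
have [e cE] := cyclotomic_power (char_poly_monic (rG g)) fpf_eigenvalue.
have d0 : (0 < totient #[g]%g)%N by rewrite totient_gt0 order_gt0.
(* Comparing degrees gives [n = totient #[g] * e]; in particular the truncated division is exact
   here. *)
have -> : (n %/ totient #[g]%g = e)%N.
  have := congr1 (fun p : {poly rat} => (size p).-1) cE.
  rewrite size_char_poly size_exp /= size_map_inj_poly ?rmorph0 //; last first.
    exact: intr_inj.
  by rewrite size_Cyclotomic /= => ->; rewrite mulnC mulnK.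
have -> : \det (rG g - 1%:M) = (- 1) ^+ n * (char_poly (rG g)).[1].
  rewrite -opprB -scaleN1r detZ; congr (_ * _).
  rewrite -[RHS]horner_evalE -det_map_mx; congr (\det _); apply/matrixP => i j.
  by rewrite !mxE /= horner_evalE !hornerE hornerMn hornerX.
rewrite normrM normrX normrN1 expr1n mul1r cE horner_exp normrX; congr (_ ^+ _).
by rewrite -[1 in LHS](rmorph1 intr) horner_map intr_norm.
Qed.

End FixedPointFree.

(* [p] if [d] is a power of the prime [p], and [1] otherwise: the exponential of
   the von Mangoldt function. *)
Definition prime_power_base (d : nat) : nat :=
  if primes d is [:: p] then p else 1%N.

Lemma prime_power_baseX p k : prime p -> (0 < k)%N ->
  prime_power_base (p ^ k) = p.
Proof. by move=> pp k0; rewrite /prime_power_base primesX // primes_prime. Qed.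

Lemma prime_power_base1 d : size (primes d) != 1%N -> prime_power_base d = 1%N.
Proof. by rewrite /prime_power_base; case: (primes d) => [|p []]. Qed.

(** Matches the divisors with a single prime factor with the pairs [(p, k)] of the double sum in the
    theorem. The pair is recovered from [p ^ k]: first [p] by [prime_power_base], then [k]. *)
Lemma perm_prime_power_divisors m : (0 < m)%N ->
  perm_eq [seq d <- divisors m | size (primes d) == 1%N]
    [seq (p ^ k)%N | p <- [seq p <- index_iota 0 m.+1 | prime p],
                     k <- [seq k <- index_iota 1 m.+1 | (p ^ k %| m)%N]].
Proof.
move=> m0; apply: uniq_perm.
- by rewrite filter_uniq // divisors_uniq.
- apply: allpairs_uniq_dep => [|p _|].
  + by rewrite filter_uniq // iota_uniq.
  + by rewrite filter_uniq // iota_uniq.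
  move=> _ _ /allpairsPdep[p [k [+ + ->]]] /allpairsPdep[q [l [+ + ->]]] /=.
  rewrite !mem_filter !mem_index_iota => /andP[pp _] /andP[_ /andP[k0 _]].
  move=> /andP[pq _] /andP[_ /andP[l0 _]] e.
  have epq : p = q by rewrite -(prime_power_baseX pp k0) e prime_power_baseX.
  by move: e; rewrite -epq => /(expnI (prime_gt1 pp)) ->.
move=> d; rewrite mem_filter -dvdn_divisors //.
apply/andP/allpairsPdep => [[dp dm]|[p [k []]]].
  have d0 : (0 < d)%N by exact: dvdn_gt0 dm.
  case E : (primes d) dp => [|p []] // _.
  have : p \in primes d by rewrite E mem_head.
  rewrite mem_primes => /and3P[pp _ pd].
  have dE : d = (p ^ logn p d)%N.
    by rewrite {1}(prod_prime_decomp d0) prime_decompE E /= big_seq1.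
  have pm : (p <= m)%N by rewrite dvdn_leq // (dvdn_trans pd).
  have lm : (logn p d <= m)%N.
    apply: leq_trans (dvdn_leq m0 dm).
    by rewrite {2}dE ltnW // ltn_expl // prime_gt1.
  exists p, (logn p d); rewrite !mem_filter !mem_index_iota pp -dE dm !ltnS pm lm.
  by rewrite logn_gt0 E mem_head.
rewrite !mem_filter !mem_index_iota => /andP[pp _] /andP[pkm /andP[k0 _]] ->.
by rewrite primesX // primes_prime.
Qed.

Lemma big_prime_power_divisors (R : Type) (idx : R) (op : Monoid.com_law idx)
    (m : nat) (F : nat -> R) : (0 < m)%N ->
  \big[op/idx]_(d <- divisors m | size (primes d) == 1%N) F d =
  \big[op/idx]_(p < m.+1 | prime p)
    \big[op/idx]_(1 <= k < m.+1 | (p ^ k %| m)%N) F (p ^ k)%N.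
Proof.
move=> m0; rewrite -big_filter (perm_big _ (perm_prime_power_divisors m0)).
rewrite big_allpairs_dep big_filter.
rewrite -(big_mkord prime (fun p =>
  \big[op/idx]_(1 <= k < m.+1 | (p ^ k %| m)%N) F (p ^ k)%N)).
by apply: eq_bigr => p _; rewrite big_filter.
Qed.

(** The exponential form of the identity that the von Mangoldt function sums to [log m] over the
    divisors of [m]: each prime [p] occurs once for every [k >= 1] with [p ^ k] dividing [m]. *)
Lemma prod_prime_power_base m : (0 < m)%N ->
  (\prod_(d <- divisors m | (1 < d)%N) prime_power_base d = m)%N.
Proof.
move=> m0; rewrite (bigID (fun d => size (primes d) == 1%N)) /=.
rewrite [X in (_ * X)%N]big1 => [|d /andP[_]]; last exact: prime_power_base1.
rewrite muln1 (eq_bigl (fun d => size (primes d) == 1%N)) => [|d]; last first.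
  by case: d => [|[|d]] //=.
rewrite big_prime_power_divisors //.
rewrite -[RHS](partnT m0) /partn big_mkord [LHS]big_mkcond; apply: eq_bigr => p _.
case: ifP => [pp|npp]; last by rewrite lognE npp.
rewrite logn_count_dvd // expn_sum.
rewrite big_mkcond big_nat_recr //= ifN; last first.
  by rewrite gtnNdvd // ltn_expl // prime_gt1.
rewrite muln1; apply: eq_big_nat => k /andP[k0 _].
by case: (_ %| _)%N => //; rewrite prime_power_baseX // expn1.
Qed.

(** Divide the factorization of ['X^m - 1] by ['X - 1] and evaluate [1 + 'X + ... + 'X^(m-1)] at
    [1]. *)
Lemma prod_cyclotomic_at1 m : (0 < m)%N ->
  \prod_(d <- divisors m | (1 < d)%N) (Cyclotomic d).[1] = m%:Z.
Proof.
move=> m0.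
have C1 : Cyclotomic 1 = 'X - 1 by have := prod_Cyclotomic (ltn0Sn 0); rewrite big_seq1.
have := prod_Cyclotomic m0.
rewrite (bigD1_seq 1%N) ?divisors_uniq ?divisor1 //= C1 subrX1 => /mulfI.
rewrite -[1]/(1%:P) polyXsubC_eq0 => /(_ isT) /(congr1 (fun p : {poly int} => p.[1])).
rewrite horner_prod horner_sum [RHS](eq_bigr (fun=> 1)) => [|i _]; last first.
  by rewrite hornerXn expr1n.
rewrite sumr_const card_ord natz => <-.
rewrite big_seq_cond [RHS]big_seq_cond; apply: eq_bigl => d.
by rewrite -dvdn_divisors //; case: d => [|[|d]] //; rewrite dvd0n eqn0Ngt m0.
Qed.

(** Both sides have product [d] over the divisors of [d] greater than [1]. By induction the proper
    divisors contribute equally, and their nonzero product cancels. *)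
Lemma cyclotomic_at1 d : (1 < d)%N -> (Cyclotomic d).[1] = (prime_power_base d)%:Z.
Proof.
elim/ltn_ind: d => d IH d1; have d0 := ltnW d1.
have := prod_cyclotomic_at1 d0.
rewrite -{2}(prod_prime_power_base d0) (big_morph Posz PoszM (erefl _)).
have dd : d \in divisors d by exact: divisors_id.
rewrite !(big_rem d dd) /= d1.
have -> : \prod_(y <- rem d (divisors d) | (1 < y)%N) (Cyclotomic y).[1] =
    \prod_(y <- rem d (divisors d) | (1 < y)%N) (prime_power_base y)%:Z.
  rewrite big_seq_cond [RHS]big_seq_cond; apply: eq_bigr => y /andP[+ y1].
  rewrite mem_rem_uniq ?divisors_uniq // inE -dvdn_divisors // => /andP[yd ydvd].
  by apply: IH => //; rewrite ltn_neqAle yd dvdn_leq.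
apply: mulIf; rewrite prodf_seq_neq0; apply/allP => y _; apply/implyP => y1.
rewrite /prime_power_base; case E : (primes y) => [|p []] //.
have : p \in primes y by rewrite E mem_head.
by rewrite mem_primes => /andP[/prime_gt0]; case: p {E}.
Qed.

(** A cyclic group has one subgroup of order [d], here [<[b]>], and the elements of order [d] are
    its generators. *)
Lemma card_order_cyclic (gT : finGroupType) (G : {group gT}) d :
  cyclic G -> (d %| #|G|)%N -> #|[set g in G | #[g]%g == d]| = totient d.
Proof.
move=> cG; have [a GE] := cyclicP cG => dG.
have m0 : (0 < #|G|)%N by exact: cardG_gt0.
pose b := (a ^+ (#|G| %/ d))%g.
have ob : #[b]%g = d.
  have oa : #[a]%g = #|G| by rewrite GE.
  rewrite orderXdiv oa ?dvdn_div //.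
  by rewrite divnA // mulKn.
have bG : b \in G by rewrite GE mem_cycle.
rewrite -{2}ob totient_gen; apply: eq_card => g; rewrite !inE /generator.
apply/andP/idP => [[gG /eqP og]|/eqP bg].
  by rewrite (eq_subG_cyclic cG) ?cycle_subG // -!orderE og ob.
have gG : g \in G by rewrite -cycle_subG -bg cycle_subG.
by split=> //; rewrite /order -bg -/(order b) ob.
Qed.

Lemma sum_order_cyclic (gT : finGroupType) (G : {group gT}) (h : nat -> rat) :
  cyclic G -> \sum_(g in G) h #[g]%g = \sum_(d <- divisors #|G|) (totient d)%:R * h d.
Proof.
move=> cG.
transitivity (\sum_(g in G) \sum_(d <- divisors #|G| | d == #[g]%g) h d).
  apply: eq_bigr => g gG; rewrite -big_filter.
  rewrite filter_pred1_uniq ?divisors_uniq ?big_seq1 //.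
  by rewrite -dvdn_divisors ?cardG_gt0 // order_dvdG.
rewrite (exchange_big_dep predT) //=; apply: eq_big_seq => d.
rewrite -dvdn_divisors ?cardG_gt0 // => dG.
rewrite -(card_order_cyclic cG dG) sumr_const mulr_natl; congr (_ *+ _).
by apply: eq_card => g; rewrite !inE eq_sym.
Qed.

Theorem corollary4p5 (R : realType) (m : nat) (hm : (1 <= m)%N)
    (gT : finGroupType) (G : {group gT}) (cycG : cyclic G)
    (cardG : #|G| = m) (n : nat) (rG : mx_representation rat G n)
    (fpf : is_FPF rG) (L : lattice n) (invL : lattice_invariant rG L) :
  is_orb_euler_char R G (X := torus R L) (torus_act R L rG)
    ((m%:R - 1) / m%:R
     + m%:R^-1 *
       \sum_(p < m.+1 | prime p)
         \sum_(1 <= k < m.+1 | (p ^ k %| m)%N)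
           (totient (p ^ k))%:R *
             (p%:R ^+ (n %/ totient (p ^ k))%N - 1)).
Proof.
pose N d := (prime_power_base d ^ (n %/ totient d))%N.
(* The identity is a separate case: [N 1] is [1], whereas the torus has Euler characteristic [0]. *)
exists (fun g => if g == 1%g then 0 else (N #[g]%g)%:Z); split=> [g gG|].
  have [->|g1] := eqVneq g 1%g.
    have [B Bu LB] := lattice_basis L.
    apply: (torus_euler_char Bu LB); first by case: fpf.
    apply/seteqP; split=> // t _; change (torus_act R L rG 1%g t = t).
    by rewrite /torus_act /complex_act repr_mx1 map_mx1 mul1mx torus_piK.
  have [M [ME Mchi]] := fixed_points_euler_char R invL gG (fpf.2 g gG g1).
  suff -> : N #[g]%g = M by [].
  apply/eqP; rewrite -(eqr_nat rat) ME (fpf_det fpf gG) cyclotomic_at1 ?order_gt1 //.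
  by rewrite natrX.
rewrite cardG [(_ - 1) / _]mulrC -mulrDr; congr (_ * _).
(* The excess over [1] of a non-identity element of order [d]. It vanishes unless [d] is a prime
   power, in particular at [d = 1], so the identity may be included in its sum. *)
pose h d : rat := (N d)%:R - 1.
have h1 d : size (primes d) != 1%N -> h d = 0.
  by move=> /prime_power_base1 e; rewrite /h /N e exp1n subrr.
transitivity (m%:R - 1 + \sum_(g in G) h #[g]%g).
  congr (_ + _); rewrite (sum_order_cyclic _ cycG) cardG.
  rewrite (bigID (fun d => size (primes d) == 1%N)) /= [X in _ = _ + X]big1 ?addr0.
    rewrite big_prime_power_divisors //; apply: eq_bigr => p pp.
    rewrite big_nat_cond [RHS]big_nat_cond; apply: eq_bigr => k /andP[/andP[k0 _] _].
    by rewrite /h /N prime_power_baseX // natrX.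
  by move=> d /h1 ->; rewrite mulr0.
rewrite (bigD1 1%g) //= h1 ?order1 // add0r.
rewrite [RHS](bigD1 1%g) //= eqxx add0r.
have -> : m%:R - 1 = \sum_(g in G | g != 1%g) 1 :> rat.
  by rewrite -cardG -sumr_const (bigD1 1%g) //= addrAC subrr add0r.
rewrite -big_split; apply: eq_bigr => g /andP[gG /negPf ->].
by rewrite /= /h [LHS]addrC subrK.
Qed.
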